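(* Suppose assumptions A1), A2), A3), A4), A5) and Ã6) (stated in the context) are satisfied. Then the value function $V$ is a Dini solution of the HJB equation $$\partial_t v(t,x)+\mathcal{H}(t,x,\partial_x v(t,x))=0,\quad (t,x)\in(0,\infty)\times\mathbb{R}^n.$$
   Context: Data: $l:[0,\infty)\times\mathbb{R}^n\times\mathbb{R}^m\to\mathbb{R}$ and $f:[0,\infty)\times\mathbb{R}^n\times\mathbb{R}^m\to\mathbb{R}^n$ are given functions, $\Omega\subset\mathbb{R}^m$ is a nonempty set (admissible control actions), and $\delta>0$ is the discount rate. For $(\tau,z)\in[0,\infty)\times\mathbb{R}^n$ let $U_{ad}[\tau,\infty):=\{w\in L^1_{loc}([\tau,\infty);\mathbb{R}^m) : w(t)\in\Omega \text{ a.e. in } [\tau,\infty)\}$. An admissible process for the initial condition $(\tau,z)$ is a pair $(x,u)$ with $u\in U_{ad}[\tau,\infty)$ and $x$ a (locally) absolutely continuous function on $[\tau,\infty)$ with $x(t)=z+\int_\tau^t f(s,x(s),u(s))\,ds$ for $t\ge\tau$. Its cost is $J(u;\tau,z):=\int_\tau^\infty e^{-\delta t}l(t,x(t),u(t))\,dt$. Let $\mathcal{D}_{\tau,z;\infty}$ be the set of admissible processes $(x,u)$ for $(\tau,z)$ with $J(u;\tau,z)<\infty$. Value function: $V:[0,\infty)\times\mathbb{R}^n\to\mathbb{R}$, $V(\tau,z):=\inf\{J(u;\tau,z) : (x,u)\in\mathcal{D}_{\tau,z;\infty}\}$. Hamiltonian: $\mathcal{H}(t,x,\lambda):=\inf_{u\in\Omega}\{\langle\lambda,f(t,x,u)\rangle+e^{-\delta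 t}l(t,x,u)\}$ for $(t,x,\lambda)\in[0,\infty)\times\mathbb{R}^n\times\mathbb{R}^n$. For $\Phi:[0,\infty)\times\mathbb{R}^n\to\mathbb{R}$: the lower Dini derivative at $(t,x)$ in direction $(\alpha,\xi)\in\mathbb{R}^{1+n}$ is $D^-\Phi(t,x;\alpha,\xi):=\liminf_{r\downarrow0;\,w\to\xi}\frac{\Phi(t+r\alpha,x+rw)-\Phi(t,x)}{r}$; the upper Dini derivative $D^+\Phi$ is defined with $\limsup$ instead. Dini sub-gradient: $\partial_D\Phi(t,x):=\{(\alpha,\xi)\in\mathbb{R}^{1+n} : D^-\Phi(t,x;u,v)\ge u\alpha+\langle v,\xi\rangle\ \forall(u,v)\in\mathbb{R}^{1+n}\}$. Dini super-gradient: $\partial^D\Phi(t,x):=\{(\alpha,\xi)\in\mathbb{R}^{1+n} : D^+\Phi(t,x;u,v)\le u\alpha+\langle v,\xi\rangle\ \forall(u,v)\in\mathbb{R}^{1+n}\}$. $\Phi$ is a Dini solution of the HJB equation if it is continuous and: (a) for all $(\tau,z)\in[0,\infty)\times\mathbb{R}^n$, $\alpha+\mathcal{H}(\tau,z,\xi)\ge0$ for all $(\alpha,\xi)\in\partial^D\Phi(\tau,z)$; (b) $\Phi(\tau,z)\to0$ as $\tau\to\infty$, uniformly for $z$ in each compact subset of $\mathbb{R}^n$; (c) for all $(\tau,z)\in[0,\infty)\times\mathbb{R}^n$, $\alpha+\mathcal{H}(\tau,z,\xi)\le0$ for all $(\alpha,\xi)\in\partial_D\Phi(\tau,z)$. Assumptions: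 A1) There exists $K_1>0$ such that for every $t\in[0,\infty)$, $u\in\Omega$: $|l(t,x,u)-l(t,z,u)|+|f(t,x,u)-f(t,z,u)|\le K_1|x-z|$ for all $x,z\in\mathbb{R}^n$. A2) There exists $K_2>0$ such that $|l(t,x,u)|+|f(t,x,u)|\le K_2(1+|x|)$ for all $t\in[0,\infty)$, $x\in\mathbb{R}^n$, $u\in\Omega$. A3) $l$ and $f$ are continuous. A4) For all $t,x$, the set $\{(e^{-\delta t}l(t,x,v),f(t,x,v))^T : v\in\Omega\}$ is convex in $\mathbb{R}^{n+1}$. A5) $\Omega$ is compact. Ã6) The Lipschitz constant $K_1$ in A1) and $\delta$ satisfy $K_1-\delta<0$. Furthermore, given $(\tau,z)\in[0,\infty)\times\mathbb{R}^n$, there exist a neighborhood $\mathcal{V}_{\tau,z}$ of $(\tau,z)$ and a bounded set $\mathcal{S}_{\tau,z}\subset\mathbb{R}^n$ such that for every initial condition $(\tilde\tau,\tilde z)\in\mathcal{V}_{\tau,z}$, every $(x,u)\in\mathcal{D}_{\tilde\tau,\tilde z;\infty}$ satisfies $x(t)\in\mathcal{S}_{\tau,z}$ for all $t\ge\tilde\tau$. *)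

(* Defs.v *)
From HB Require Import structures.
From mathcomp Require Import all_boot all_order all_algebra.
From mathcomp Require Import all_classical all_reals all_analysis.

Set Implicit Arguments.
Unset Strict Implicit.
Unset Printing Implicit Defensive.

Import Order.TTheory GRing.Theory Num.Theory.
Import numFieldNormedType.Exports.

Local Open Scope classical_set_scope.
Local Open Scope ring_scope.

(* The library norm on 'rV[R]_n is the max norm (it induces the usual topology);
   the Lipschitz and growth constants below refer to the Euclidean norm. *)
Definition dotv (R : realType) (n : nat) (x y : 'rV[R]_n) : R :=
  \sum_(i < n) x 0 i * y 0 i.

Definition enorm (R : realType) (n : nat) (x : 'rV[R]_n) : R :=
  Num.sqrt (dotv x x).

Section AbsoluteContinuity.
Variables (R : realType) (n : nat).

Definition abs_continuous (a b : R) (x : R -> 'rV[R]_n) : Prop :=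
  forall e : R, 0 < e -> exists2 d : R, 0 < d &
    forall (N : nat) (c c' : 'I_N -> R),
      (forall i, [/\ a <= c i, c i <= c' i & c' i <= b]) ->
      trivIset [set: 'I_N] (fun i => `]c i, c' i[%classic) ->
      \sum_(i < N) (c' i - c i) < d ->
      \sum_(i < N) enorm (x (c' i) - x (c i)) < e.

Definition loc_abs_continuous (tau : R) (x : R -> 'rV[R]_n) : Prop :=
  forall T : R, tau <= T -> abs_continuous tau T x.

End AbsoluteContinuity.

(* Functions on [0, +oo[ (or [tau, +oo[) are represented by functions on R;
   their values at other times are never used. *)
Section ControlProblem.
Variables (R : realType) (n m : nat).
Variables (l : R -> 'rV[R]_n -> 'rV[R]_m -> R).
Variables (f : R -> 'rV[R]_n -> 'rV[R]_m -> 'rV[R]_n).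
Variables (Omega : set 'rV[R]_m) (delta : R).

Local Notation mu := (@lebesgue_measure R).

Definition L1loc (tau : R) (w : R -> 'rV[R]_m) : Prop :=
  forall T : R, tau <= T ->
    forall j, mu.-integrable `[tau, T] (fun t => (w t 0 j)%:E).

Definition admissible_control (tau : R) (u : R -> 'rV[R]_m) : Prop :=
  L1loc tau u /\ {ae mu, forall t, tau <= t -> Omega (u t)}.

Definition admissible_process (tau : R) (z : 'rV[R]_n)
    (x : R -> 'rV[R]_n) (u : R -> 'rV[R]_m) : Prop :=
  [/\ admissible_control tau u,
      loc_abs_continuous tau x &
      forall t, tau <= t -> forall i,
        mu.-integrable `[tau, t] (fun s => (f s (x s) (u s) 0 i)%:E) /\
        x t 0 i = z 0 i + \int[mu]_(s in `[tau, t]) f s (x s) (u s) 0 i].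

Definition running_cost (x : R -> 'rV[R]_n) (u : R -> 'rV[R]_m) (t : R) : \bar R :=
  (expR (- (delta * t)) * l t (x t) (u t))%:E.

Definition cost (tau : R) (x : R -> 'rV[R]_n) (u : R -> 'rV[R]_m) : \bar R :=
  (\int[mu]_(t in `[tau, +oo[) running_cost x u t)%E.

(* The integral is not of the form oo - oo, which the library evaluates to -oo. *)
Definition cost_defined (tau : R) (x : R -> 'rV[R]_n) (u : R -> 'rV[R]_m) : Prop :=
  (\int[mu]_(t in `[tau, +oo[) ((running_cost x u)^\+ t) < +oo)%E \/
  (\int[mu]_(t in `[tau, +oo[) ((running_cost x u)^\- t) < +oo)%E.

Definition finite_cost_processes (tau : R) (z : 'rV[R]_n) :
    set ((R -> 'rV[R]_n) * (R -> 'rV[R]_m)) :=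
  [set xu | [/\ admissible_process tau z xu.1 xu.2,
                cost_defined tau xu.1 xu.2 &
                (cost tau xu.1 xu.2 < +oo)%E]].

Definition value (tau : R) (z : 'rV[R]_n) : \bar R :=
  ereal_inf [set cost tau xu.1 xu.2 | xu in finite_cost_processes tau z].

Definition hamiltonian (t : R) (x lambda : 'rV[R]_n) : \bar R :=
  ereal_inf [set (dotv lambda (f t x u) + expR (- (delta * t)) * l t x u)%:E
            | u in Omega].

Definition assumption1 (K1 : R) : Prop :=
  forall (t : R) (u : 'rV[R]_m), 0 <= t -> Omega u -> forall x z : 'rV[R]_n,
    `|l t x u - l t z u| + enorm (f t x u - f t z u) <= K1 * enorm (x - z).

Definition assumption2 (K2 : R) : Prop :=
  forall (t : R) (x : 'rV[R]_n) (u : 'rV[R]_m), 0 <= t -> Omega u ->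
    `|l t x u| + enorm (f t x u) <= K2 * (1 + enorm x).

Definition assumption3 : Prop :=
  {within [set p : R * 'rV[R]_n * 'rV[R]_m | 0 <= p.1.1],
    continuous (fun p => l p.1.1 p.1.2 p.2)} /\
  {within [set p : R * 'rV[R]_n * 'rV[R]_m | 0 <= p.1.1],
    continuous (fun p => f p.1.1 p.1.2 p.2)}.

Definition assumption4 : Prop :=
  forall (t : R) (x : 'rV[R]_n), 0 <= t ->
    @convex_set R (R^o * 'rV[R]_n)%type
      [set (expR (- (delta * t)) * l t x v, f t x v) | v in Omega].

Definition assumption5 : Prop := compact Omega.

Definition assumption6 (K1 : R) : Prop :=
  K1 - delta < 0 /\
  forall (tau : R) (z : 'rV[R]_n), 0 <= tau ->
    exists2 S : set 'rV[R]_n, bounded_set S &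
      \forall p \near (tau, z), 0 <= p.1 ->
        forall xu, finite_cost_processes p.1 p.2 xu ->
          forall t : R, p.1 <= t -> S (xu.1 t).

End ControlProblem.

Section DiniSolution.
Variables (R : realType) (n : nat).
Implicit Types (Phi : R -> 'rV[R]_n -> R).

Definition dini_quotient Phi (t : R) (x : 'rV[R]_n) (alpha : R)
    (p : R * 'rV[R]_n) : \bar R :=
  ((Phi (t + p.1 * alpha) (x + p.1 *: p.2) - Phi t x) / p.1)%:E.

(* r decreases to 0 and w tends to xi, along the pairs (r, w) at which the
   quotient only involves times in [0, +oo[.  For t > 0 the restriction holds
   eventually.  For t = 0 and alpha < 0 it is never satisfied: the lower
   derivative is then +oo and the upper one -oo (inf and sup of the empty set),
   so that such directions do not constrain sub- and super-gradients. *)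
Definition dini_filter (t alpha : R) (xi : 'rV[R]_n) :
    set_system (R * 'rV[R]_n) :=
  within [set p : R * 'rV[R]_n | 0 <= t + p.1 * alpha]
    (filter_prod (0 : R)^'+ (nbhs xi)).

Definition lower_dini Phi (t : R) (x : 'rV[R]_n) (alpha : R) (xi : 'rV[R]_n) :
    \bar R :=
  limf_einf (dini_quotient Phi t x alpha) (dini_filter t alpha xi).

Definition upper_dini Phi (t : R) (x : 'rV[R]_n) (alpha : R) (xi : 'rV[R]_n) :
    \bar R :=
  limf_esup (dini_quotient Phi t x alpha) (dini_filter t alpha xi).

Definition dini_subgradient Phi (t : R) (x : 'rV[R]_n) : set (R * 'rV[R]_n) :=
  [set g | forall (u : R) (v : 'rV[R]_n),
     ((u * g.1 + dotv v g.2)%:E <= lower_dini Phi t x u v)%E].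

Definition dini_supergradient Phi (t : R) (x : 'rV[R]_n) : set (R * 'rV[R]_n) :=
  [set g | forall (u : R) (v : 'rV[R]_n),
     (upper_dini Phi t x u v <= (u * g.1 + dotv v g.2)%:E)%E].

Definition dini_solution (H : R -> 'rV[R]_n -> 'rV[R]_n -> \bar R) Phi : Prop :=
  [/\ {within [set p : R * 'rV[R]_n | 0 <= p.1],
        continuous (fun p => Phi p.1 p.2)},
      forall (tau : R) (z : 'rV[R]_n), 0 <= tau -> forall g, dini_supergradient Phi tau z g ->
        (0 <= g.1%:E + H tau z g.2)%E,
      forall K : set 'rV[R]_n, compact K ->
        {uniform K, Phi @ +oo --> (fun=> 0)} &
      forall (tau : R) (z : 'rV[R]_n), 0 <= tau -> forall g, dini_subgradient Phi tau z g ->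
        (g.1%:E + H tau z g.2 <= 0)%E].

End DiniSolution.

(* Main.v *)
Require Import Defs.
From HB Require Import structures.
From mathcomp Require Import all_boot all_order all_algebra.
From mathcomp Require Import all_classical all_reals all_analysis.
From mathcomp Require Import measurable_realfun.
From mathcomp Require Import ring lra.
Import Order.TTheory GRing.Theory Num.Theory.
Import numFieldNormedType.Exports.
Set Implicit Arguments.
Unset Strict Implicit.
Unset Printing Implicit Defensive.
Local Open Scope classical_set_scope.
Local Open Scope ring_scope.

(** The dynamics are Lipschitz in the state with constant K1, so Gronwall's
    inequality makes every trajectory grow at most like exp(K1 (t - tau)), and two
    trajectories driven by the same control separate at most at that rate.  Since
    K1 < delta, the discount beats this growth.  Every admissible process
    therefore has an absolutely convergent cost, bounded by a multiple of
    (1 + |z|) exp(- delta tau) ([payoff_integrable]), and the cost is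
    Lipschitz in the initial state, uniformly in the control ([payoff_lip]).  The
    first bound gives finiteness of the value function and its uniform decay on
    compact sets ([value_vanishes]).

    Trajectories exist for every measurable control ([trajectory_exists], by
    Picard iteration) and can be restricted and concatenated; this yields the
    dynamic programming principle ([dynamic_programming_le],
    [dynamic_programming_opt]).  Together with the Lipschitz estimate in the state
    it makes the value function locally Lipschitz in time, hence continuous
    ([value_continuous]).

    The two differential inequalities read the dynamic programming principle on a
    short interval [tau, tau + r].

    - Supergradients ([value_supergradient]): for a constant control a, the
      trajectory leaves z with velocity f(tau, z, a), and along it the difference
      quotients of the value are at least the average of minus the running cost.
      So the upper Dini derivative in the direction (1, f(tau, z, a)) is at least
      - exp(- delta tau) l(tau, z, a).

    - Subgradients ([value_subgradient]): suppose that
      alpha + <xi, f(tau, z, a)> + exp(- delta tau) l(tau, z, a) >= eta > 0 for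
      every a in Omega.  By compactness of Omega the same holds with eta / 2 at all
      states near (tau, z), hence also on average along an r^2-optimal process on
      [tau, tau + r].  The mean velocities w_r of these processes are bounded; let v
      be a cluster point as r tends to 0.  By near-optimality the difference
      quotients along w_r stay below alpha + <xi, w_r> - eta / 2 + r, whereas a
      subgradient forces them to come close to, or exceed, alpha + <xi, v>.

    The problem is first transferred to data F and L that are continuous at all
    times (time is clamped to [0, +oo[ inside f and l), to controls that take
    values in Omega everywhere and to states that are measurable on the whole line.
    [trajectory_finite_cost] and [finite_cost_trajectory] show that both
    formulations produce the same set of costs. *)

(** * The Euclidean norm *)

Section EuclideanNorm.
Variables (R : realType) (n : nat).
Implicit Types (x y z : 'rV[R]_n) (a : R).

Lemma dotvC x y : dotv x y = dotv y x.
Proof. by apply: eq_bigr => i _; rewrite mulrC. Qed.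

Lemma dotvDl x y z : dotv (x + y) z = dotv x z + dotv y z.
Proof. by rewrite -big_split; apply: eq_bigr => i _; rewrite mxE mulrDl. Qed.

Lemma dotvZl a x y : dotv (a *: x) y = a * dotv x y.
Proof. by rewrite big_distrr; apply: eq_bigr => i _; rewrite mxE -mulrA. Qed.

Lemma dotvBl x y z : dotv (x - y) z = dotv x z - dotv y z.
Proof. by rewrite -scaleN1r dotvDl dotvZl mulN1r. Qed.

Lemma dotv_ge0 x : 0 <= dotv x x.
Proof. by apply: sumr_ge0 => i _; rewrite -expr2 sqr_ge0. Qed.

Lemma enorm_ge0 x : 0 <= enorm x.
Proof. exact: sqrtr_ge0. Qed.

Lemma sqr_enorm x : enorm x ^+ 2 = dotv x x.
Proof. by rewrite sqr_sqrtr// dotv_ge0. Qed.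

Lemma normr_coord_enorm x i : `|x 0 i| <= enorm x.
Proof.
rewrite -(sqrtr_sqr (x 0 i)) ler_wsqrtr// /dotv (bigD1 i)//= -expr2 lerDl.
by apply: sumr_ge0 => j _; rewrite -expr2 sqr_ge0.
Qed.

Lemma enorm_eq0 x : enorm x = 0 -> x = 0.
Proof.
move=> x0; apply/rowP => i; apply/eqP; rewrite mxE -normr_le0 -x0.
exact: normr_coord_enorm.
Qed.

Lemma cauchy_schwarz x y : dotv x y <= enorm x * enorm y.
Proof.
have [/enorm_eq0->|x0] := eqVneq (enorm x) 0.
  by rewrite -(scale0r 0) dotvZl mul0r mulr_ge0// enorm_ge0.
have [/enorm_eq0->|y0] := eqVneq (enorm y) 0.
  by rewrite dotvC -(scale0r 0) dotvZl mul0r mulr_ge0// enorm_ge0.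
have xy0 : 0 < enorm x * enorm y by rewrite mulr_gt0// lt0r enorm_ge0 ?x0 ?y0.
have := dotv_ge0 (enorm y *: x - enorm x *: y).
rewrite dotvBl !dotvZl (dotvC x) (dotvC y) !dotvBl !dotvZl (dotvC y x).
rewrite -!sqr_enorm => h.
rewrite -(ler_pM2l xy0); lra.
Qed.

Lemma enormZ a x : enorm (a *: x) = `|a| * enorm x.
Proof.
by rewrite /enorm dotvZl dotvC dotvZl mulrA -expr2 sqrtrM ?sqr_ge0// sqrtr_sqr.
Qed.

Lemma enormN x : enorm (- x) = enorm x.
Proof. by rewrite -scaleN1r enormZ normrN1 mul1r. Qed.

Lemma enorm0 : enorm (0 : 'rV[R]_n) = 0.
Proof. by rewrite -(scale0r 0) enormZ normr0 mul0r. Qed.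

Lemma ler_enormD x y : enorm (x + y) <= enorm x + enorm y.
Proof.
rewrite -(@ler_pXn2r _ 2) ?nnegrE ?addr_ge0 ?enorm_ge0//.
rewrite sqrrD sqr_enorm dotvDl !(dotvC _ (x + y)) !dotvDl -!sqr_enorm (dotvC y x).
have := cauchy_schwarz x y; lra.
Qed.

Lemma enorm_distC x y : enorm (x - y) = enorm (y - x).
Proof. by rewrite -enormN opprB. Qed.

Lemma ler_enorm_sum x : enorm x <= \sum_i `|x 0 i|.
Proof.
have S0 : 0 <= \sum_i `|x 0 i| by apply: sumr_ge0.
rewrite -(@ler_pXn2r _ 2) ?nnegrE ?enorm_ge0// sqr_enorm expr2 big_distrl/=.
apply: ler_sum => i _; apply: le_trans (ler_norm _) _; rewrite normrM.
rewrite ler_wpM2l// (bigD1 i)//= lerDl; exact: sumr_ge0.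
Qed.

(** The topology of ['rV_n] is that of the max norm, while the constant K1 refers to
    the Euclidean norm; this lemma and [ler_enorm_mxnorm] pass from one to the
    other. *)
Lemma ler_mxnorm_enorm x : `|x| <= enorm x.
Proof.
rewrite /Num.norm/= mx_normrE; apply/bigmax_leP; split=> [|[j i] _ /=].
  exact: enorm_ge0.
by rewrite (ord1 j) normr_coord_enorm.
Qed.

Lemma ler_enorm_mxnorm x : enorm x <= n%:R * `|x|.
Proof.
apply: le_trans (ler_enorm_sum _) _.
rewrite mulr_natl -[X in _ *+ X](card_ord n) -sumr_const ler_sum// => i _.
rewrite [leRHS]/Num.norm/= mx_normrE; apply/bigmax_geP; right => /=.
by exists (0, i).
Qed.

End EuclideanNorm.

Lemma continuous_dotv (R : realType) n (v : 'rV[R]_n) : continuous (dotv v).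
Proof.
move=> a; apply/(@cvgrPdist_le _ _ _ (nbhs a)) => e e0.
have C0 : 0 < enorm v * n%:R + 1 by rewrite ltr_wpDl// mulr_ge0// enorm_ge0.
near=> b.
rewrite -(dotvC a) -(dotvC b) -dotvBl.
have h : `|dotv (a - b) v| <= enorm v * n%:R * `|a - b|.
  have c x : dotv x v <= enorm v * n%:R * `|x|.
    apply: le_trans (cauchy_schwarz _ _) _; rewrite mulrC -mulrA.
    by rewrite ler_wpM2l ?enorm_ge0// ler_enorm_mxnorm.
  rewrite ler_norml c andbT lerNl -mulN1r -dotvZl scaleN1r.
  by apply: le_trans (c _) _; rewrite normrN.
apply: le_trans h _; apply: le_trans (_ : (enorm v * n%:R + 1) * `|a - b| <= _).
  by rewrite ler_wpM2r// lerDl.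
rewrite mulrC -ler_pdivlMr//; near: b.
apply: filterS (nbhsx_ballx a _ (divr_gt0 e0 C0)) => b.
by rewrite mx_norm_ball => /ltW.
Unshelve. all: by end_near. Qed.

(** * Locally bounded measurable functions and their integrals *)

Section LocallyBoundedMeasurable.
Variable R : realType.
Implicit Types (g h : R -> R) (a b c k : R).
Local Notation mu := (@lebesgue_measure R).

(** This class contains running costs and velocities along trajectories, and it is
    stable under the cutting and pasting of controls, which destroys continuity;
    its members are integrable on every bounded interval. *)
Definition lbm g : Prop := measurable_fun setT g /\
  forall T : R, exists M : R, forall s, `|s| <= T -> `|g s| <= M.

Lemma lbm_cst c : lbm (cst c).
Proof. by split=> [|T]; [exact: measurable_cst|exists `|c|]. Qed.

Lemma lbmD g h : lbm g -> lbm h -> lbm (fun s => g s + h s).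
Proof.
move=> [mg bg] [mh bh]; split=> [|T]; first exact: measurable_funD.
have [[M gM] [N hN]] := (bg T, bh T); exists (M + N) => s sT.
by rewrite (le_trans (ler_normD _ _))// lerD ?gM ?hN.
Qed.

Lemma lbmM g h : lbm g -> lbm h -> lbm (fun s => g s * h s).
Proof.
move=> [mg bg] [mh bh]; split=> [|T]; first exact: measurable_funM.
have [[M gM] [N hN]] := (bg T, bh T); exists (M * N) => s sT.
by rewrite normrM ler_pM// ?gM ?hN.
Qed.

Lemma lbmZ c g : lbm g -> lbm (fun s => c * g s).
Proof. exact/lbmM/lbm_cst. Qed.

Lemma lbmB g h : lbm g -> lbm h -> lbm (fun s => g s - h s).
Proof.
move=> lg lh; rewrite (_ : (fun s => _) = (fun s => g s + -1 * h s)).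
  exact/lbmD/lbmZ.
by apply/funext => s; rewrite mulN1r.
Qed.

Lemma lbm_norm g : lbm g -> lbm (fun s => `|g s|).
Proof.
move=> [mg bg]; split=> [|T]; first exact: measurableT_comp.
by have [M gM] := bg T; exists M => s sT; rewrite normr_id gM.
Qed.

Lemma lbm_sum (I : Type) (r : seq I) (g : I -> R -> R) :
  (forall i, lbm (g i)) -> lbm (fun s => \sum_(i <- r) g i s).
Proof.
move=> lg; elim: r => [|i r IH].
  under eq_fun do rewrite big_nil; exact: lbm_cst.
by under eq_fun do rewrite big_cons; exact: lbmD.
Qed.

Lemma lbm_le g h : measurable_fun setT g -> lbm h -> (forall s, `|g s| <= h s) ->
  lbm g.
Proof.
move=> mg [_ bh] gh; split=> // T; have [M hM] := bh T; exists M => s sT.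
by rewrite (le_trans (gh s))// (le_trans (ler_norm _))// hM.
Qed.

Lemma lbm_continuous g : continuous g -> lbm g.
Proof.
move=> cg; split=> [|T]; first exact: continuous_measurable_fun.
have /compact_bounded[M [Mr gM]] : compact (g @` `[- T, T]).
  apply: continuous_compact; last exact: segment_compact.
  exact: continuous_subspaceT.
exists (M + 1) => s sT; apply: gM; first by rewrite ltrDl.
by exists s => //=; rewrite in_itv/= -ler_norml.
Qed.

Lemma lbm_if c g h : lbm g -> lbm h -> lbm (fun s => if s <= c then g s else h s).
Proof.
move=> [mg bg] [mh bh]; split=> [|T].
  apply: measurable_fun_ifT => //.
  exact: measurable_fun_ler.
have [[M gM] [N hN]] := (bg T, bh T); exists (M + N) => s sT.
have := gM s sT; have := hN s sT => hsN gsM.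
case: ifP => _.
  by rewrite (le_trans gsM)// lerDl (le_trans _ hsN).
by rewrite (le_trans hsN)// lerDr (le_trans _ gsM).
Qed.

Lemma lbm_integrable g a b : lbm g -> mu.-integrable `[a, b] (EFin \o g).
Proof.
move=> [mg bg]; apply: measurable_bounded_integrable => //.
- by rewrite /= lebesgue_measure_itv; case: ifP => // _; rewrite -EFinB ltry.
- exact: measurable_funTS.
have [M gM] := bg (`|a| + `|b|).
exists M; split; first by rewrite num_real.
move=> N MN s /=; rewrite in_itv/= => /andP[aS sb].
apply: le_trans (ltW MN); apply: gM.
have := ler_norm (- a); have := ler_norm b; rewrite normrN => ? ?.
have := normr_ge0 a; have := normr_ge0 b => ? ?.
rewrite ler_norml; lra.
Qed.

End LocallyBoundedMeasurable.

Section IntegralOnIntervals.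
Variable R : realType.
Implicit Types (g h : R -> R) (a b c k : R).
Local Notation mu := (@lebesgue_measure R).

Definition integ a b g : R := \int[mu]_(s in `[a, b]) g s.

Lemma integ_point a g : integ a a g = 0.
Proof. by rewrite /integ set_itv1 Rintegral_set1. Qed.

Lemma eq_integ a b g h : (forall s, a <= s <= b -> g s = h s) ->
  integ a b g = integ a b h.
Proof. by move=> gh; apply: eq_Rintegral => s; rewrite inE/= in_itv/= => /gh. Qed.

(** Integrands obtained by pasting at time [a] need not agree at [a] itself. *)
Lemma eq_integ_oc a b g h : lbm g -> lbm h ->
  (forall s, a < s <= b -> g s = h s) -> integ a b g = integ a b h.
Proof.
move=> lg lh gh.
have io (k : R -> R) : lbm k -> mu.-integrable `]a, b] (EFin \o k).
  move=> lk; apply: integrableS (lbm_integrable a b lk) => //.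
  by apply: subset_itvr; rewrite bnd_simp.
rewrite /integ -!Rintegral_itv_obnd_cbnd; [|exact: io..].
by apply: eq_Rintegral => s; rewrite inE/= in_itv/= => /gh.
Qed.

Lemma integ_split a b c g : lbm g -> a <= b -> b <= c ->
  integ a c g = integ a b g + integ b c g.
Proof.
move=> lg ab bc; have ig := lbm_integrable _ _ lg.
rewrite (_ : integ b c g = integ a c g - integ a b g); first by rewrite addrC subrK.
rewrite /integ (@Rintegral_itvB _ _ _ _ b (ig a c)) ?bnd_simp//.
rewrite Rintegral_itv_obnd_cbnd//; apply: integrableS (ig b c) => //.
by apply: subset_itvr; rewrite bnd_simp.
Qed.

Lemma integD a b g h : lbm g -> lbm h ->
  integ a b (fun s => g s + h s) = integ a b g + integ a b h.
Proof. by move=> lg lh; rewrite /integ RintegralD//; exact: lbm_integrable. Qed.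

Lemma integB a b g h : lbm g -> lbm h ->
  integ a b (fun s => g s - h s) = integ a b g - integ a b h.
Proof. by move=> lg lh; rewrite /integ RintegralB//; exact: lbm_integrable. Qed.

Lemma integZ a b k g : lbm g ->
  integ a b (fun s => k * g s) = k * integ a b g.
Proof. by move=> lg; rewrite /integ RintegralZl//; exact: lbm_integrable. Qed.

Lemma ler_integ a b g h : lbm g -> lbm h ->
  (forall s, a <= s <= b -> g s <= h s) -> integ a b g <= integ a b h.
Proof.
move=> lg lh gh; apply: le_Rintegral => //.
- exact: lbm_integrable lg.
- exact: lbm_integrable lh.
Qed.

Lemma normr_integ a b g : lbm g ->
  `|integ a b g| <= integ a b (fun s => `|g s|).
Proof. by move=> lg; apply: le_normr_Rintegral => //; exact: lbm_integrable. Qed.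

Lemma integ_cst a b c : a <= b -> integ a b (fun=> c) = c * (b - a).
Proof.
move=> ab; rewrite /integ Rintegral_cst//= lebesgue_measure_itv/=.
rewrite lte_fin; case: ltP => // ba; have -> : a = b by apply/eqP; rewrite eq_le ab.
by rewrite subrr.
Qed.

Lemma integ_sum (I : Type) (r : seq I) a b (g : I -> R -> R) :
  (forall i, lbm (g i)) ->
  integ a b (fun s => \sum_(i <- r) g i s) = \sum_(i <- r) integ a b (g i).
Proof.
move=> lg; elim: r => [|i r IH].
  under eq_integ do rewrite big_nil.
  by rewrite big_nil /integ Rintegral_cst// mul0r.
rewrite big_cons -IH -integD//; last exact: lbm_sum.
by apply: eq_integ => s _; rewrite big_cons.
Qed.

Lemma ler_integ_cst a b g c : lbm g -> a <= b ->
  (forall s, a <= s <= b -> g s <= c) -> integ a b g <= c * (b - a).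
Proof.
by move=> lg ab gc; rewrite -integ_cst//; apply: ler_integ => //; exact: lbm_cst.
Qed.

Lemma continuous_expR_affine k a : continuous (fun s : R => expR (k * (s - a))).
Proof.
move=> s; apply: (continuous_comp (f := fun s : R => k * (s - a))); last first.
  exact: continuous_expR.
by apply: cvgM; [exact: cvg_cst|apply: cvgB; [exact: cvg_id|exact: cvg_cst]].
Qed.

Lemma lbm_expR k a : lbm (fun s => expR (k * (s - a))).
Proof. exact/lbm_continuous/continuous_expR_affine. Qed.

Lemma is_derive_expR_affine k a (s : R) : k != 0 ->
  is_derive s 1 (fun s => k^-1 * expR (k * (s - a))) (expR (k * (s - a))).
Proof.
move=> k0; apply: is_derive_eq; rewrite /GRing.scale/=; field.
exact: k0.
Qed.

Lemma integ_expR a b k : k != 0 -> a <= b ->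
  integ a b (fun s => expR (k * (s - a))) = k^-1 * (expR (k * (b - a)) - 1).
Proof.
move=> k0; rewrite le_eqVlt => /predU1P[->|ab].
  by rewrite integ_point subrr mulr0 expR0 subrr mulr0.
have dF := is_derive_expR_affine a _ k0.
rewrite /integ /Rintegral (@continuous_FTC2 _ _ (fun s => k^-1 * expR (k * (s - a))) a b)//=.
- by rewrite subrr mulr0 expR0; ring.
- apply: continuous_subspaceT; exact: continuous_expR_affine.
- have cF : continuous (fun s : R => k^-1 * expR (k * (s - a))).
    by move=> s; apply: cvgM; [exact: cvg_cst|exact: continuous_expR_affine].
  split; first by move=> s _; have [] := dF s.
  + exact/cvg_at_right_filter/cF.
  + exact/cvg_at_left_filter/cF.
- by move=> s _; rewrite derive1E; exact: derive_val.
Qed.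

Lemma integral_expR_infty a k : 0 < k ->
  (\int[mu]_(s in `[a, +oo[) (expR (- k * (s - a)))%:E = (k^-1)%:E)%E.
Proof.
move=> k0; have Nk0 : - k != 0 by rewrite oppr_eq0 lt0r_neq0.
have dF s := is_derive_expR_affine a s Nk0.
have cF : continuous (fun s : R => (- k)^-1 * expR (- k * (s - a))).
  by move=> s; apply: cvgM; [exact: cvg_cst|exact: continuous_expR_affine].
rewrite (@ge0_continuous_FTC2y _ _ (fun s => (- k)^-1 * expR (- k * (s - a))) a 0).
- by rewrite subrr mulr0 expR0 mulr1 invrN EFinN oppeK add0e.
- by move=> s _; exact: expR_ge0.
- apply: continuous_subspaceT; exact: continuous_expR_affine.
- rewrite -[X in _ --> X](mulr0 (- k)^-1); apply: cvgM; first exact: cvg_cst.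
  have -> : (fun s => expR (- k * (s - a))) =
            (fun z => expR (- z)) \o (fun s => k * (s - a)).
    by apply: eq_fun => s /=; rewrite mulNr.
  apply: (@cvg_comp _ _ _ _ _ _ (pinfty_nbhs R)); last exact: cvgr_expR.
  apply/cvgryPge => A; near=> s.
  rewrite mulrC -ler_pdivrMr// lerBrDr; near: s; apply: nbhs_pinfty_ge; exact: num_real.
- by move=> s _; have [] := dF s.
- exact/cvg_at_right_filter/cF.
- by move=> s _; rewrite derive1E; exact: derive_val.
Unshelve. all: by end_near. Qed.

Lemma integ_incr g (M tau s t : R) : lbm g -> tau <= s -> s <= t ->
  (forall r, s <= r <= t -> `|g r| <= M) ->
  `|integ tau t g - integ tau s g| <= M * (t - s).
Proof.
move=> lg ts st gM; rewrite (integ_split lg ts st) addrAC subrr add0r.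
apply: le_trans (normr_integ _ _ lg) _.
by apply: ler_integ_cst => //; exact: lbm_norm.
Qed.

Lemma integ_reversed a b g : b < a -> integ a b g = 0.
Proof. by move=> ba; rewrite /integ set_itv_ge ?Rintegral_set0// bnd_simp -ltNge. Qed.

(** The primitive is even continuous: it is locally Lipschitz, because it vanishes to
    the left of [tau] and [integ_incr] applies to its right. *)
Lemma lbm_primitive g tau : lbm g -> lbm (fun t => integ tau t g).
Proof.
move=> lg; apply: lbm_continuous => t0.
have [_ /(_ (`|tau| + `|t0| + 1))[M gM]] := lg.
have M0 : 0 <= M.
  by apply: le_trans (normr_ge0 (g 0)) _; apply: gM; rewrite normr0 !addr_ge0.
have ineq s t : `|s| <= `|t0| + 1 -> `|t| <= `|t0| + 1 -> s <= t ->
    `|integ tau t g - integ tau s g| <= M * (t - s).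
  move=> sT tT st.
  have gM' r : tau <= r \/ s <= r -> r <= t -> `|g r| <= M.
    move=> h rt; apply: gM; rewrite ler_norml.
    move: sT tT; rewrite !ler_norml => /andP[? ?] /andP[? ?].
    have := ler_norm (- tau); rewrite normrN; have := normr_ge0 tau => ? ?.
    by case: h => ?; lra.
  have [ts|st'] := leP tau s.
    by apply: integ_incr => // r /andP[? ?]; apply: gM' => //; right.
  rewrite (integ_reversed _ st') subr0.
  have [tt|tt] := ltP t tau.
    by rewrite integ_reversed// normr0 mulr_ge0// subr_ge0.
  rewrite -[integ _ _ _]subr0 -(integ_point tau g).
  apply: le_trans (@integ_incr _ M _ _ _ lg _ tt _) _ => //.
    by move=> r /andP[? ?]; apply: gM' => //; left.
  by rewrite ler_wpM2l//; lra.
apply/cvgrPdist_le => e e0; near=> t.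
have t1 : `|t0 - t| <= 1 by near: t; exact: cvgr_dist_le.
have t2 : `|t0 - t| <= e / (M + 1).
  by near: t; apply: cvgr_dist_le => //; rewrite divr_gt0// ltr_wpDl.
have t3 : `|t| <= `|t0| + 1.
  by rewrite -(subKr t0 t) (le_trans (ler_normB _ _))// lerD2l.
have t4 : `|t0| <= `|t0| + 1 by rewrite lerDl.
have : M * `|t0 - t| <= e.
  apply: le_trans (_ : (M + 1) * `|t0 - t| <= e); first by rewrite ler_wpM2r// lerDl.
  by rewrite mulrC -ler_pdivlMr// ltr_wpDl.
apply: le_trans; have [h|h] := leP t t0.
  by rewrite (ger0_norm (_ : 0 <= t0 - t)) ?subr_ge0//; exact: ineq.
by rewrite distrC (distrC t0) (gtr0_norm (_ : 0 < t - t0)) ?subr_gt0//;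
  apply: ineq => //; exact: ltW.
Unshelve. all: by end_near. Qed.

End IntegralOnIntervals.

Section HalfLine.
Variable R : realType.
Local Notation mu := (@lebesgue_measure R).

(** Costs over the half-line are only ever estimated through this domination by an
    exponential. *)
Lemma integrable_exp_decay (g : R -> R) (a C k : R) : 0 < k -> lbm g ->
  (forall s, a <= s -> `|g s| <= C * expR (- k * (s - a))) ->
  mu.-integrable `[a, +oo[ (EFin \o g) /\ `|\int[mu]_(s in `[a, +oo[) g s| <= C / k.
Proof.
move=> k0 [mg bg] gC.
have iE : mu.-integrable `[a, +oo[ (EFin \o (fun s => expR (- k * (s - a)))).
  apply/integrableP; split.
    by apply/measurable_EFinP; apply: measurable_funTS; have [] := lbm_expR (- k) a.
  under eq_integral do rewrite /= ger0_norm ?expR_ge0//.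
  by rewrite integral_expR_infty// ltry.
have iC : mu.-integrable `[a, +oo[ (EFin \o (fun s => C * expR (- k * (s - a)))).
  rewrite (_ : _ \o _ = (fun s => C%:E * (EFin \o (fun s => expR (- k * (s - a)))) s)%E).
    exact: integrableZl.
  by apply/funext => s; rewrite /= EFinM.
have ig : mu.-integrable `[a, +oo[ (EFin \o g).
  apply: le_integrable iC => //.
    by apply/measurable_EFinP; exact: measurable_funTS.
  move=> s /=; rewrite in_itv/= andbT => as_; rewrite lee_fin.
  by rewrite (le_trans (gC s as_))// ler_norm.
split=> //; apply: le_trans (le_normr_Rintegral _ ig) _ => //.
have -> : C / k = \int[mu]_(s in `[a, +oo[) (C * expR (- k * (s - a))).
  by rewrite RintegralZl//; congr (_ * _); rewrite /Rintegral integral_expR_infty.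
apply: le_Rintegral => //.
- exact: (integrable_abse ig).
- by move=> s /=; rewrite in_itv/= andbT => /gC.
Qed.

End HalfLine.

(** * Integrals of vector-valued functions *)

Section VectorIntegral.
Variables (R : realType) (n : nat).
Implicit Types (x y : R -> 'rV[R]_n) (a b c : R).

Definition lbmv x : Prop := forall i, lbm (fun s => x s 0 i).

Definition vinteg a b x : 'rV[R]_n := \row_i integ a b (fun s => x s 0 i).

Lemma lbm_dotv x y : lbmv x -> lbmv y -> lbm (fun s => dotv (x s) (y s)).
Proof. by move=> lx ly; apply: lbm_sum => i; exact: lbmM. Qed.

Lemma lbmv_cst (v : 'rV[R]_n) : lbmv (fun=> v).
Proof. by move=> i; exact: lbm_cst. Qed.

Lemma lbmvB x y : lbmv x -> lbmv y -> lbmv (fun s => x s - y s).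
Proof.
move=> lx ly i; rewrite (_ : (fun s => _) = (fun s => x s 0 i - y s 0 i)).
  exact: lbmB.
by apply/funext => s; rewrite !mxE.
Qed.

Lemma lbm_enorm x : lbmv x -> lbm (fun s => enorm (x s)).
Proof.
move=> lx; apply: (lbm_le (h := fun s => \sum_i `|x s 0 i|)).
- apply: (@measurableT_comp _ _ _ _ _ _ (@Num.sqrt R)).
    by apply: continuous_measurable_fun; exact: sqrt_continuous.
  by have [] := lbm_dotv lx lx.
- by apply: lbm_sum => i; apply: lbm_norm; exact: lx.
- by move=> s; rewrite ger0_norm ?enorm_ge0// ler_enorm_sum.
Qed.

Lemma lbmv_le x (h : R -> R) : (forall i, measurable_fun setT (fun s => x s 0 i)) ->
  lbm h -> (forall s, enorm (x s) <= h s) -> lbmv x.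
Proof.
move=> mx lh xh i; apply: lbm_le (mx i) lh _ => s.
exact: le_trans (normr_coord_enorm _ _) (xh s).
Qed.

Lemma dotv_vinteg a b (v : 'rV[R]_n) x : lbmv x ->
  dotv v (vinteg a b x) = integ a b (fun s => dotv v (x s)).
Proof.
move=> lx; rewrite /dotv integ_sum => [|i]; last exact/lbmZ/lx.
by apply: eq_bigr => i _; rewrite mxE integZ//; exact: lx.
Qed.

(** Passing through coordinates would lose a dimensional factor, and with it the
    sharp growth rate K1 that has to be compared with delta.  So the integral [v] is
    paired with itself: <v, v> is the integral of <v, x s>, and Cauchy-Schwarz
    applies under the integral. *)
Lemma enorm_vinteg a b x : lbmv x ->
  enorm (vinteg a b x) <= integ a b (fun s => enorm (x s)).
Proof.
move=> lx; set v := vinteg a b x.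
have I0 : 0 <= integ a b (fun s => enorm (x s)).
  by apply: Rintegral_ge0 => s _; exact: enorm_ge0.
have [->//|v0] := eqVneq (enorm v) 0.
have vp : 0 < enorm v by rewrite lt0r v0 enorm_ge0.
rewrite -(ler_pM2l vp) -expr2 sqr_enorm -integZ; last exact: lbm_enorm.
rewrite {2}/v dotv_vinteg//; apply: ler_integ => [||s _]; last exact: cauchy_schwarz.
  exact/lbm_dotv/lx/lbmv_cst.
exact/lbmZ/lbm_enorm.
Qed.

Lemma vinteg_point a x : vinteg a a x = 0.
Proof. by apply/rowP => i; rewrite !mxE integ_point. Qed.

Lemma vinteg_split a b c x : lbmv x -> a <= b -> b <= c ->
  vinteg a c x = vinteg a b x + vinteg b c x.
Proof. by move=> lx ab bc; apply/rowP => i; rewrite !mxE (integ_split (lx i) ab bc). Qed.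

Lemma vintegB a b x y : lbmv x -> lbmv y ->
  vinteg a b (fun s => x s - y s) = vinteg a b x - vinteg a b y.
Proof.
move=> lx ly; apply/rowP => i; rewrite !mxE -integB//.
by apply: eq_integ => s _; rewrite !mxE.
Qed.

Lemma eq_vinteg a b x y : (forall s, a <= s <= b -> x s = y s) ->
  vinteg a b x = vinteg a b y.
Proof. by move=> xy; apply/rowP => i; rewrite !mxE; apply: eq_integ => s /xy ->. Qed.

End VectorIntegral.

(** * Geometric sequences and Gronwall's inequality *)

Section GeometricLimit.
Variable R : realType.

Lemma le0_of_geometric_bounds (x C : R) : (forall k : nat, x <= C / 2 ^+ k) -> x <= 0.
Proof.
move=> xC; rewrite leNgt; apply/negP => x0.
have [C0|C0] := leP C 0.
  by have := xC 0%N; rewrite expr0 divr1 => h; lra.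
have /archi_boundP : 0 <= C / x by rewrite divr_ge0 ?ltW.
set k := Num.bound _ => Ck.
have := xC k; rewrite ler_pdivlMr ?exprn_gt0// leNgt => /negP; apply.
rewrite mulrC -ltr_pdivrMr// (lt_le_trans Ck)//.
by rewrite -natrX ler_nat ltnW// ltn_expl.
Qed.

(** The limit is a supremum: adding or subtracting the tail of the geometric series
    turns [w] into a nonincreasing or a nondecreasing sequence. *)
Lemma geometric_limit (w : nat -> R) (B : R) :
  (forall k, `|w k.+1 - w k| <= B / 2 ^+ k) ->
  exists l, forall k, `|l - w k| <= 2 * B / 2 ^+ k.
Proof.
move=> wB; pose g k : R := 2 * B / 2 ^+ k.
pose b k : R := B / 2 ^+ k.
have gS k : g k = b k + g k.+1.
  by rewrite /g /b exprS; field; rewrite expf_neq0.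
have B0 : 0 <= B by have := wB 0%N; rewrite expr0 divr1; apply: le_trans.
have g0 k : 0 <= g k by rewrite divr_ge0 ?mulr_ge0 ?exprn_ge0.
have incr k j : w k - g k <= w (k + j)%N - g (k + j)%N.
  elim: j => [|j IH]; first by rewrite addn0.
  apply: le_trans IH _; rewrite addnS; have := wB (k + j)%N.
  by rewrite -/(b _) (gS (k + j)%N) ler_norml => /andP[? ?]; lra.
have decr k j : w (k + j)%N + g (k + j)%N <= w k + g k.
  elim: j => [|j IH]; first by rewrite addn0.
  apply: le_trans _ IH; rewrite addnS; have := wB (k + j)%N.
  by rewrite -/(b _) (gS (k + j)%N) ler_norml => /andP[? ?]; lra.
have cross k j : w k - g k <= w j + g j.
  apply: le_trans (incr k j) _; rewrite addnC; apply: le_trans (decr j k).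
  by have := g0 (j + k)%N; lra.
exists (sup (range (fun k => w k - g k))) => k; rewrite ler_distl -/(g k).
apply/andP; split.
  apply: ub_le_sup; last by exists k.
  by exists (w k + g k) => _ [j _ <-].
apply: ge_sup; first by exists (w 0%N - g 0%N), 0%N.
by move=> _ [j _ <-]; exact: cross.
Qed.

Lemma geometric_cvg (w : nat -> R) (l C : R) :
  (forall k, `|l - w k| <= C / 2 ^+ k) -> w @ \oo --> l.
Proof.
move=> wC; apply/cvgrPdist_le => e e0.
have C0 : 0 <= C by have := wC 0%N; rewrite expr0 divr1; apply: le_trans.
have : 0 <= C / e by rewrite divr_ge0// ltW.
move=> /archi_boundP; set N := Num.bound _ => CN.
near=> k; apply: le_trans (wC k) _.
rewrite ler_pdivrMr ?exprn_gt0// mulrC -ler_pdivrMr// (le_trans (ltW CN))//.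
rewrite -natrX ler_nat; apply: (@leq_trans k); last by rewrite ltnW// ltn_expl.
by near: k; exact: nbhs_infty_ge.
Unshelve. all: by end_near. Qed.

End GeometricLimit.

Section Gronwall.
Variable R : realType.

(** Starting from an arbitrary bound M, each use of the hypothesis keeps the term
    c exp(K (t - tau)) and halves the error, which is measured with the faster
    weight exp(2 K (t - tau)): integrating K times that weight gives back at most
    half of it. *)
Lemma gronwall (phi : R -> R) (c K tau T : R) : 0 < K -> lbm phi ->
  (forall t, tau <= t <= T -> phi t <= c + K * integ tau t phi) ->
  forall t, tau <= t <= T -> phi t <= c * expR (K * (t - tau)).
Proof.
move=> K0 lphi phiK.
have lE k := lbm_expR k tau.
have [_ /(_ (`|tau| + `|T|))[M Mb]] := lbmB lphi (lbmZ c (lE K)).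
(* M bounds |phi - c exp(K (t - tau))| on [tau, T]. *)
have key k t : tau <= t <= T ->
    phi t <= c * expR (K * (t - tau)) + M / 2 ^+ k * expR (2 * K * (t - tau)).
  have M0 : 0 <= M by apply: le_trans (normr_ge0 _) (Mb 0 _); rewrite normr0 addr_ge0.
  elim: k t => [|k IH] t tT.
    rewrite -lerBlDl expr0 divr1; apply: le_trans (ler_norm _) _.
    apply: le_trans (Mb t _) _.
      case/andP: tT => t1 t2; have := ler_norm T; have := ler_norm (- tau).
      rewrite normrN => *; have := normr_ge0 tau; have := normr_ge0 T => *.
      by rewrite ler_norml; lra.
    rewrite ler_peMr// -expR0 ler_expR mulr_ge0//; first by rewrite mulr_ge0// ltW.
    by case/andP: tT; rewrite subr_ge0.
  have [t1 t2] := andP tT.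
  apply: le_trans (phiK t tT) _.
  have K2 : 2 * K != 0 by lra.
  have Kn : K != 0 by lra.
  have h : integ tau t phi <= c * (K^-1 * (expR (K * (t - tau)) - 1)) +
     M / 2 ^+ k * ((2 * K)^-1 * (expR (2 * K * (t - tau)) - 1)).
    rewrite -!integ_expR// -!integZ// -integD; [|exact: lbmZ..].
    apply: ler_integ => [//||s /andP[s1 s2]]; first by apply: lbmD; exact: lbmZ.
    by apply: IH; rewrite s1 (le_trans s2).
  have := ler_wpM2l (ltW K0) h.
  rewrite mulrDr exprS.
  rewrite (_ : K * (c * (K^-1 * (expR (K * (t - tau)) - 1))) =
    c * (expR (K * (t - tau)) - 1)); last by field.
  rewrite (_ : K * (M / 2 ^+ k * ((2 * K)^-1 * (expR (2 * K * (t - tau)) - 1))) =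
    M / (2 * 2 ^+ k) * (expR (2 * K * (t - tau)) - 1)); last first.
    by field; rewrite expf_neq0// Kn.
  have : 0 <= M / (2 * 2 ^+ k) by rewrite divr_ge0// mulr_ge0// exprn_ge0.
  lra.
move=> t tT; rewrite -subr_le0.
apply: (@le0_of_geometric_bounds _ _ (M * expR (2 * K * (t - tau)))) => k.
by rewrite lerBlDl mulrAC; exact: key.
Qed.

End Gronwall.

(** * Measurability of continuous functions along measurable curves *)

Section MeasurablePreimage.
Variable R : realType.

(** An open set is the union of the balls of radius 1/(k+1) around points of a
    countable dense family that it contains, and this union is countable. *)
Lemma measurable_preimage_open (T : pseudoMetricType R) (I : countType)
    (q : I -> T) (h : R -> T) :
  (forall p e, 0 < e -> exists k, ball p e (q k)) ->
  (forall k e, measurable (h @^-1` ball (q k) e)) ->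
  forall O, open O -> measurable (h @^-1` O).
Proof.
move=> dq mq O oO.
pose F (k : I * nat) := if `[< ball (q k.1) k.2.+1%:R^-1 `<=` O >]
  then h @^-1` ball (q k.1) k.2.+1%:R^-1 else set0.
rewrite (_ : h @^-1` O = \bigcup_k F k).
  apply: countable_bigcupT_measurable => [|k]; first exact: countableP.
  by rewrite /F; case: ifP => _.
apply/seteqP; split=> [s /= Os|s [k _]]; last first.
  by rewrite /F; case: ifPn => // /asboolP kO /= /kO.
have /nbhs_ballP[e /= e0 eO] : nbhs (h s) O by exact: open_nbhs_nbhs.
have [N Ne] : exists N : nat, N.+1%:R^-1 < e / 2.
  have [N _ /(_ N (leqnn N)) h1] := near_infty_natSinv_lt (PosNum (divr_gt0 e0 (ltr0n R 2))).
  by exists N.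
have N0 : 0 < N.+1%:R^-1 :> R by rewrite invr_gt0 ltr0n.
have [k hk] := dq (h s) _ N0.
exists (k, N) => //; rewrite /F /= ifT; first exact: ball_sym.
apply/asboolP => y ky; apply: eO; rewrite [e]splitr.
apply: ball_triangle (le_ball (ltW Ne) hk) (le_ball (ltW Ne) ky).
Qed.

Lemma dense_ratr (x e : R) : 0 < e -> exists r : rat, ball x e (ratr r).
Proof.
move=> e0; have : x - e < x + e by lra.
move=> /rat_in_itvoo[r]; rewrite in_itv/= => /andP[r1 r2]; exists r.
by rewrite /ball/= distrC ltr_distl r1 r2.
Qed.

Lemma dense_map_ratr n (v : 'rV[R]_n) (e : R) : 0 < e ->
  exists w : 'rV[rat]_n, ball v e (map_mx ratr w).
Proof.
move=> e0; have /choice[w vw] := fun i => dense_ratr (v 0 i) e0.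
by exists (\row_i w i); split=> // i j; rewrite !mxE (ord1 i); exact: vw.
Qed.

Lemma measurable_preimage_ball n (x : R -> 'rV[R]_n) (v : 'rV[R]_n) e :
  (forall i, measurable_fun setT (fun s => x s 0 i)) ->
  measurable (x @^-1` ball v e).
Proof.
move=> mx; have [e0|e0] := ltP 0 e; last first.
  rewrite (_ : _ @^-1` _ = set0)//; apply/seteqP; split=> // s [/= h _].
  by move: h; rewrite ltNge e0.
rewrite (_ : _ @^-1` _ =
    \bigcap_(i in [set: 'I_n]) ((fun s => x s 0 i) @^-1` ball (v 0 i) e)).
  apply: fin_bigcap_measurable => [|i _]; first exact: finite_finset.
  by rewrite -[X in measurable X]setTI; apply: mx => //; exact: measurable_ball.
apply/seteqP; split=> [s [_ vs] i _|s vs]; first exact: vs.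
by split=> // i j; rewrite (ord1 i); exact: vs.
Qed.

Lemma measurable_rV_preimage_open n (x : R -> 'rV[R]_n) O :
  (forall i, measurable_fun setT (fun s => x s 0 i)) ->
  open O -> measurable (x @^-1` O).
Proof.
move=> mx; apply: (@measurable_preimage_open 'rV[R]_n _ (map_mx ratr)).
- by move=> p e; exact: dense_map_ratr.
- by move=> k e; exact: measurable_preimage_ball.
Qed.

Lemma measurable_along_curves n m (G : R * 'rV[R]_n * 'rV[R]_m -> R)
    (x : R -> 'rV[R]_n) (u : R -> 'rV[R]_m) :
  continuous G ->
  (forall i, measurable_fun setT (fun s => x s 0 i)) ->
  (forall j, measurable_fun setT (fun s => u s 0 j)) ->
  measurable_fun setT (fun s => G (s, x s, u s)).
Proof.
move=> cG mx mu.
apply: (measurability _ (RGenOInfty.measurableE R)) => /= _ [_ [a ->]] <-.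
rewrite setTI.
pose h s := (s, x s, u s).
rewrite (_ : _ @^-1` _ = h @^-1` (G @^-1` `]a, +oo[))//.
apply: (@measurable_preimage_open (R * 'rV[R]_n * 'rV[R]_m)%type
  (rat * 'rV[rat]_n * 'rV[rat]_m)%type
  (fun k => (ratr k.1.1, map_mx ratr k.1.2, map_mx ratr k.2))) => [[[p y] w] e e0|k e|].
- have [[r pr] [v yv] [z wz]] := And3 (dense_ratr p e0) (dense_map_ratr y e0) (dense_map_ratr w e0).
  by exists (r, v, z).
- rewrite (_ : _ @^-1` _ = ball (ratr k.1.1 : R) e `&`
    (x @^-1` ball (map_mx ratr k.1.2 : 'rV[R]_n) e)
    `&` (u @^-1` ball (map_mx ratr k.2 : 'rV[R]_m) e))//.
  apply: measurableI; last exact: measurable_preimage_ball.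
  by apply: measurableI; [exact: measurable_ball|exact: measurable_preimage_ball].
- by apply: open_comp => [p _|]; [exact: cG|exact: interval_open].
Qed.

End MeasurablePreimage.

(** * Trajectories of the controlled equation *)

Section ControlSystem.
Variables (R : realType) (n m : nat).
Variables (F : R -> 'rV[R]_n -> 'rV[R]_m -> 'rV[R]_n) (Omega : set 'rV[R]_m).
Variables (K1 K2 : R).
Hypotheses (K1_gt0 : 0 < K1) (K2_gt0 : 0 < K2).
Hypothesis F_continuous :
  continuous (fun p : R * 'rV[R]_n * 'rV[R]_m => F p.1.1 p.1.2 p.2).
Hypothesis F_lip : forall t u, Omega u -> forall x z,
  enorm (F t x u - F t z u) <= K1 * enorm (x - z).
Hypothesis F_growth : forall t x u, Omega u -> enorm (F t x u) <= K2 + K1 * enorm x.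
Implicit Types (x y : R -> 'rV[R]_n) (u : R -> 'rV[R]_m) (tau t s T : R).

(** Values in [Omega] are required at every time, not only almost everywhere; see
    [control_modification]. *)
Definition control u : Prop :=
  (forall s, Omega (u s)) /\ forall j, measurable_fun setT (fun s => u s 0 j).

Definition trajectory tau (z : 'rV[R]_n) u x : Prop :=
  lbmv x /\
  forall t, tau <= t -> x t = z + vinteg tau t (fun s => F s (x s) (u s)).

Lemma lbmv_dynamics u x : control u -> lbmv x -> lbmv (fun s => F s (x s) (u s)).
Proof.
move=> [uO mu] lx; apply: (@lbmv_le _ _ _ (fun s => K2 + K1 * enorm (x s))).
- move=> i; pose G (p : R * 'rV[R]_n * 'rV[R]_m) := F p.1.1 p.1.2 p.2 0 i.
  apply: (@measurable_along_curves _ _ _ G) => // [p|j]; last by have [] := lx j.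
  apply: (@continuous_comp _ _ _ (fun p : R * 'rV[R]_n * 'rV[R]_m => F p.1.1 p.1.2 p.2)
    (fun v : 'rV[R]_n => v 0 i)); first exact: F_continuous.
  exact: coord_continuous.
- by apply: lbmD; [exact: lbm_cst|apply: lbmZ; exact: lbm_enorm].
- by move=> s; exact: F_growth.
Qed.

Fixpoint picard tau z u (k : nat) : R -> 'rV[R]_n :=
  if k is k'.+1 then
    fun t => z + vinteg tau t (fun s => F s (picard tau z u k' s) (u s))
  else fun=> z.

Lemma lbmv_picard tau z u k : control u -> lbmv (picard tau z u k).
Proof.
move=> cu; elim: k => [|k IH] /=; first exact: lbmv_cst.
move=> i; rewrite (_ : (fun s => _) = (fun t => z 0 i +
    integ tau t (fun s => F s (picard tau z u k s) (u s) 0 i))).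
  by apply: lbmD; [exact: lbm_cst|apply: lbm_primitive; exact: lbmv_dynamics].
by apply/funext => t; rewrite !mxE.
Qed.

Lemma enorm_vinteg_dynamics u x y tau t : control u -> lbmv x -> lbmv y ->
  enorm (vinteg tau t (fun s => F s (x s) (u s)) -
         vinteg tau t (fun s => F s (y s) (u s))) <=
  K1 * integ tau t (fun s => enorm (x s - y s)).
Proof.
move=> cu lx ly; rewrite -vintegB; [|exact: lbmv_dynamics..].
apply: le_trans (enorm_vinteg _ _ _) _.
  by apply: lbmvB; exact: lbmv_dynamics.
have lxy : lbm (fun s => enorm (x s - y s)) by apply: lbm_enorm; exact: lbmvB.
rewrite -integZ//; apply: ler_integ.
- by apply: lbm_enorm; apply: lbmvB; exact: lbmv_dynamics.
- exact: lbmZ.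
- by move=> s _; apply: F_lip; have [] := cu.
Qed.

(** The weight for which the Picard map contracts by a factor 1/2 on the whole
    half-line at once. *)
Let E tau t := expR (2 * K1 * (t - tau)).

Let integ_E tau t : tau <= t -> K1 * integ tau t (E tau) <= E tau t / 2.
Proof.
move=> tt; have K1n : K1 != 0 by rewrite lt0r_neq0.
have K2n : 2 * K1 != 0 by rewrite mulf_neq0.
rewrite /E integ_expR//.
rewrite (_ : K1 * _ = (expR (2 * K1 * (t - tau)) - 1) / 2); last by field.
by rewrite ler_wpM2r// gerDl oppr_le0.
Qed.

Let lbm_E tau : lbm (E tau). Proof. exact: lbm_expR. Qed.

(** To the left of [tau] all iterates equal [z], so the bound holds at all times. *)
Lemma picard_cauchy tau z u : control u -> exists C, forall k t,
  enorm (picard tau z u k.+1 t - picard tau z u k t) <= C / 2 ^+ k * E tau t.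
Proof.
move=> cu; pose c := K2 + K1 * enorm z.
have c0 : 0 <= c by rewrite addr_ge0 ?mulr_ge0 ?enorm_ge0// ltW.
exists (c / (2 * K1)) => k t.
have C0 j : 0 <= c / (2 * K1) / 2 ^+ j.
  by rewrite !divr_ge0 ?mulr_ge0 ?exprn_ge0// ltW.
have [tt|tt] := ltP t tau.
  have p0 j : picard tau z u j t = z.
    by case: j => //= j; apply/rowP => i; rewrite !mxE integ_reversed// addr0.
  by rewrite !p0 subrr enorm0 mulr_ge0// expR_ge0.
elim: k t tt => [|k IH] t tt.
  rewrite /= addrAC subrr add0r expr0 divr1.
  apply: le_trans (enorm_vinteg _ _ _) _.
    by apply: lbmv_dynamics => //; exact: lbmv_cst.
  apply: le_trans (@ler_integ_cst _ _ _ _ c _ tt _) _.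
  - by apply: lbm_enorm; apply: lbmv_dynamics => //; exact: lbmv_cst.
  - by move=> s _; apply: F_growth; have [] := cu.
  rewrite -mulrA ler_wpM2l// mulrC ler_pdivlMr ?mulr_gt0// mulrC.
  apply: le_trans (expR_ge1Dx _); lra.
rewrite [picard _ _ _ k.+2]/= {2}[picard]/= opprD addrACA subrr add0r.
have lp j : lbmv (picard tau z u j) by exact: lbmv_picard.
apply: le_trans (@enorm_vinteg_dynamics u _ _ _ _ cu (lp k.+1) (lp k)) _.
have h : integ tau t (fun s => enorm (picard tau z u k.+1 s - picard tau z u k s)) <=
    c / (2 * K1) / 2 ^+ k * integ tau t (E tau).
  rewrite -integZ//; apply: ler_integ => [||s /andP[s1 _]]; last exact: IH.
    by apply: lbm_enorm; exact: lbmvB.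
  exact: lbmZ.
apply: le_trans (ler_wpM2l (ltW K1_gt0) h) _.
rewrite mulrCA; apply: le_trans (ler_wpM2l (C0 k) (integ_E tt)) _.
rewrite le_eqVlt; apply/orP; left; apply/eqP; rewrite exprS; field.
by rewrite ?expf_neq0 ?lt0r_neq0.
Qed.

Lemma trajectory_exists tau z u : control u -> exists x, trajectory tau z u x.
Proof.
move=> cu; have [C PC] := picard_cauchy tau z cu.
set p := picard tau z u in PC.
have E0 t : 0 < E tau t by exact: expR_gt0.
have lp k : lbmv (p k) by exact: lbmv_picard.
have /choice[x0 x0P] : forall t, exists v : 'rV[R]_n, forall k i,
    `|v 0 i - p k t 0 i| <= 2 * (C * E tau t) / 2 ^+ k.
  move=> t; have /choice[l lP] : forall i, exists l, forall k,
      `|l - p k t 0 i| <= 2 * (C * E tau t) / 2 ^+ k.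
    move=> i; apply: geometric_limit => k.
    rewrite mulrAC; apply: le_trans (PC k t).
    by apply: le_trans (normr_coord_enorm _ i); rewrite !mxE.
  by exists (\row_i l i) => k i; rewrite mxE.
pose C' := n%:R * (2 * C).
have xp k t : enorm (x0 t - p k t) <= C' / 2 ^+ k * E tau t.
  apply: le_trans (ler_enorm_sum _) _.
  rewrite (_ : C' / _ * _ = n%:R * (2 * (C * E tau t) / 2 ^+ k)); last first.
    by rewrite /C'; field; rewrite expf_neq0.
  rewrite mulr_natl -[X in _ *+ X](card_ord n) -sumr_const ler_sum// => i _.
  by rewrite !mxE.
have lx : lbmv x0.
  apply: (@lbmv_le _ _ _ (fun t => enorm z + C' * E tau t)).
  - move=> i; apply: (measurable_fun_cvg (h := fun k t => p k t 0 i)).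
      by move=> k; have [] := lp k i.
    by move=> t _; apply: geometric_cvg => k; exact: x0P.
  - by apply: lbmD; [exact: lbm_cst|exact: lbmZ].
  - move=> t; have := xp 0%N t; rewrite expr0 divr1 => h.
    rewrite -[x0 t](subrK z) addrC; apply: le_trans (ler_enormD _ _) _.
    by rewrite lerD2l.
exists x0; split=> // t tt.
apply/eqP; rewrite -subr_eq0; apply/eqP/enorm_eq0/eqP.
rewrite eq_le enorm_ge0 andbT.
apply: (@le0_of_geometric_bounds _ _ (C' * E tau t)) => k.
have -> : x0 t - (z + vinteg tau t (fun s => F s (x0 s) (u s))) =
   (x0 t - p k.+1 t) + (vinteg tau t (fun s => F s (p k s) (u s)) -
     vinteg tau t (fun s => F s (x0 s) (u s))).
  by rewrite /p/= -/p; apply/rowP => i; rewrite !mxE; lra.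
apply: le_trans (ler_enormD _ _) _.
have C'0 j : 0 <= C' / 2 ^+ j.
  by rewrite -(pmulr_lge0 _ (E0 t)); apply: le_trans (xp j t); exact: enorm_ge0.
have -> : C' * E tau t / 2 ^+ k = C' / 2 ^+ k.+1 * E tau t + C' / 2 ^+ k * (E tau t / 2).
  by rewrite exprS; field; rewrite expf_neq0.
apply: lerD; first exact: xp.
apply: le_trans (@enorm_vinteg_dynamics u _ _ _ _ cu (lp k) lx) _.
have h : integ tau t (fun s => enorm (p k s - x0 s)) <= C' / 2 ^+ k * integ tau t (E tau).
  rewrite -integZ//; apply: ler_integ => [||s _]; last by rewrite enorm_distC.
    by apply: lbm_enorm; exact: lbmvB.
  exact: lbmZ.
apply: le_trans (ler_wpM2l (ltW K1_gt0) h) _.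
rewrite mulrCA; exact: (ler_wpM2l (C'0 k) (integ_E tt)).
Qed.

(** The shift by K2 / K1 turns the affine bound K2 + K1 |x| on the velocity into a
    linear one, so that Gronwall's inequality gives the exact rate K1. *)
Lemma trajectory_growth tau z u x t : control u -> trajectory tau z u x -> tau <= t ->
  enorm (x t) + K2 / K1 <= (enorm z + K2 / K1) * expR (K1 * (t - tau)).
Proof.
move=> cu [lx xE] tt.
have K1n : K1 != 0 by rewrite lt0r_neq0.
have lphi : lbm (fun s => enorm (x s) + K2 / K1).
  by apply: lbmD; [exact: lbm_enorm|exact: lbm_cst].
apply: (@gronwall _ (fun s => enorm (x s) + K2 / K1) _ _ _ t) => //; last first.
  by rewrite tt lexx.
move=> s /andP[ts st]; rewrite addrAC lerD2r xE//.
apply: le_trans (ler_enormD _ _) _; rewrite lerD2l.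
have lF : lbmv (fun s => F s (x s) (u s)) by exact: lbmv_dynamics.
apply: le_trans (enorm_vinteg _ _ lF) _.
rewrite -integZ//; apply: ler_integ => [||r _].
- exact: lbm_enorm.
- exact: lbmZ.
rewrite mulrDr mulrC mulrCA divff// mulr1 addrC mulrC.
by apply: F_growth; have [] := cu.
Qed.

Lemma trajectory_lip tau z z' u x y t : control u ->
  trajectory tau z u x -> trajectory tau z' u y -> tau <= t ->
  enorm (x t - y t) <= enorm (z - z') * expR (K1 * (t - tau)).
Proof.
move=> cu [lx xE] [ly yE] tt.
apply: (@gronwall _ (fun s => enorm (x s - y s)) _ _ _ t) => //; last first.
- by rewrite tt lexx.
- move=> s /andP[ts st]; rewrite xE// yE// opprD addrACA.
  apply: le_trans (ler_enormD _ _) _; rewrite lerD2l.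
  exact: enorm_vinteg_dynamics.
- by apply: lbm_enorm; exact: lbmvB.
Qed.

(** The linear rate at which a trajectory leaves its initial point does not depend on
    the control; all estimates on short intervals rest on this uniformity. *)
Lemma trajectory_displacement tau z u x s : control u -> trajectory tau z u x ->
  tau <= s <= tau + 1 ->
  enorm (x s - z) <= K1 * (enorm z + K2 / K1) * expR K1 * (s - tau).
Proof.
move=> cu tx /andP[ts st]; have [lx xE] := tx.
have K1n : K1 != 0 by rewrite lt0r_neq0.
rewrite xE// addrAC subrr add0r.
have lF : lbmv (fun s => F s (x s) (u s)) by exact: lbmv_dynamics.
apply: le_trans (enorm_vinteg _ _ lF) _.
apply: ler_integ_cst => //; first exact: lbm_enorm.
move=> r /andP[tr rs]; have [uO _] := cu.
apply: le_trans (F_growth _ _ (uO r)) _.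
have -> : K2 + K1 * enorm (x r) = K1 * (enorm (x r) + K2 / K1) by field.
rewrite -mulrA ler_pM2l//; apply: le_trans (trajectory_growth cu tx tr) _.
apply: ler_wpM2l.
  by rewrite addr_ge0 ?enorm_ge0// divr_ge0// ltW.
rewrite ler_expR ler_piMr ?(ltW K1_gt0)//; lra.
Qed.

Lemma trajectory_restrict tau tau' z u x : control u -> tau <= tau' ->
  trajectory tau z u x -> trajectory tau' (x tau') u x.
Proof.
move=> cu tt [lx xE]; split=> // t tt'.
rewrite (xE _ (le_trans tt tt')) (xE _ tt) -addrA -vinteg_split//.
exact: lbmv_dynamics.
Qed.

Definition concat T {X : Type} (x y : R -> X) (s : R) : X :=
  if s <= T then x s else y s.

Lemma control_concat T u v : control u -> control v -> control (concat T u v).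
Proof.
move=> [uO mu] [vO mv]; split=> [s|j]; first by rewrite /concat; case: ifP.
rewrite (_ : (fun s => _) = (fun s => if s <= T then u s 0 j else v s 0 j)).
  apply: measurable_fun_ifT => //; exact: measurable_fun_ler.
by apply/funext => s; rewrite /concat; case: ifP.
Qed.

Lemma lbmv_concat T x y : lbmv x -> lbmv y -> lbmv (concat T x y).
Proof.
move=> lx ly i; rewrite (_ : (fun s => _) = (fun s => if s <= T then x s 0 i else y s 0 i)).
  exact: lbm_if.
by apply/funext => s; rewrite /concat; case: ifP.
Qed.

(** After [T] the integrand differs from that of [y] and [v] only at the time [T]
    itself, which the integral does not see. *)
Lemma trajectory_concat tau T z u x v y : tau <= T -> control u -> control v ->
  trajectory tau z u x -> trajectory T (x T) v y ->
  trajectory tau z (concat T u v) (concat T x y).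
Proof.
move=> tT cu cv [lx xE] [ly yE].
have lc : lbmv (concat T x y) by exact: lbmv_concat.
split=> // t tt.
have left s : s <= T -> F s (concat T x y s) (concat T u v s) = F s (x s) (u s).
  by rewrite /concat => ->.
have right s : T < s -> F s (concat T x y s) (concat T u v s) = F s (y s) (v s).
  by rewrite /concat leNgt => ->.
have ltau t' : t' <= T -> vinteg tau t' (fun s => F s (concat T x y s) (concat T u v s)) =
    vinteg tau t' (fun s => F s (x s) (u s)).
  by move=> t'T; apply: eq_vinteg => s /andP[_ st]; apply: left; apply: le_trans st t'T.
have [tle|Tt] := leP t T.
  by rewrite ltau// {1}/concat tle xE.
rewrite {1}/concat leNgt Tt/= (yE _ (ltW Tt)) (xE _ tT) -addrA; congr (_ + _).
have lF := lbmv_dynamics (control_concat T cu cv) lc.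
rewrite (vinteg_split lF tT (ltW Tt)) ltau//; congr (_ + _).
apply/rowP => i; rewrite !mxE; apply: eq_integ_oc => [||s /andP[Ts _]].
- exact: (lbmv_dynamics cv ly).
- exact: lF.
- by rewrite right.
Qed.

End ControlSystem.

(** * Dini derivatives along curves *)

Section DiniAlongCurves.
Variable R : realType.

Lemma average_cvg (g : R -> R) (tau : R) : lbm g ->
  g s @[s --> tau^'+] --> g tau ->
  (r^-1 * integ tau (tau + r) g) @[r --> 0^'+] --> g tau.
Proof.
move=> lg /cvgrPdist_le gcvg; apply/cvgrPdist_le => e e0.
have [d /= d0 gd] := gcvg e e0.
near=> r.
have r0 : 0 < r by near: r; exact: nbhs_right_gt.
have rd : r < d by near: r; exact: nbhs_right_lt.
have tr : tau <= tau + r by rewrite lerDl ltW.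
have -> : g tau - r^-1 * integ tau (tau + r) g =
    r^-1 * integ tau (tau + r) (fun s => g tau - g s).
  rewrite integB//; last exact: lbm_cst.
  by rewrite integ_cst//; field; rewrite lt0r_neq0.
rewrite normrM normfV (gtr0_norm r0) ler_pdivrMl//.
have lgg : lbm (fun s => g tau - g s) by apply: lbmB => //; exact: lbm_cst.
apply: le_trans (normr_integ _ _ lgg) _.
have -> : r * e = e * (tau + r - tau) by ring.
apply: ler_integ_cst => //; first exact: lbm_norm.
move=> s /andP[ts sr]; move: ts; rewrite le_eqVlt => /predU1P[<-|ts].
  by rewrite subrr normr0 ltW.
by apply: gd => //=; rewrite distrC gtr0_norm ?subr_gt0//; lra.
Unshelve. all: by end_near. Qed.

Lemma cvg_rowP n (T : Type) (G : set_system T) (w : T -> 'rV[R]_n) (v : 'rV[R]_n) :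
  Filter G -> (forall i, w r 0 i @[r --> G] --> v 0 i) -> w @ G --> v.
Proof.
move=> FG wv; apply/cvg_ballP => e e0.
have : \forall r \near G, forall i, ball (v 0 i) e (w r 0 i).
  by apply: filter_forall => i; move: (wv i) => /cvg_ballP; exact.
by apply: filterS => r wr; split=> // i j; rewrite (ord1 i).
Qed.

Variables (n : nat) (Phi : R -> 'rV[R]_n -> R) (tau : R) (z : 'rV[R]_n).
Hypothesis tau0 : 0 <= tau.

Let q (r : R) (v : 'rV[R]_n) := (Phi (tau + r) (z + r *: v) - Phi tau z) / r.

(** Every set of the filter that defines the derivative in the direction (1, v)
    contains the points (r, w r) for small r. *)
Lemma upper_dini_ge (w : R -> 'rV[R]_n) (v : 'rV[R]_n) (c : R) :
  w r @[r --> 0^'+] --> v ->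
  (forall e, 0 < e -> \forall r \near 0^'+, c - e <= q r (w r)) ->
  (c%:E <= upper_dini Phi tau z 1 v)%E.
Proof.
move=> wv cq; rewrite /upper_dini limf_esupE.
apply: le_ereal_inf_tmp => _ [A FA <-].
apply/lee_subgt0Pr => e e0.
have cw : (r, w r) @[r --> 0^'+] --> ((0 : R)^'+, nbhs v).
  by apply: cvg_pair wv; exact: cvg_id.
have [r [[Ar r0] qr]] : exists r, ((0 <= tau + r * 1 -> A (r, w r)) /\ 0 < r) /\ c - e <= q r (w r).
  apply: (@filter_ex _ (0 : R)^'+); near=> r; split; first split.
  - by near: r; exact: (cw _ FA).
  - by near: r; exact: nbhs_right_gt.
  - by near: r; exact: cq.
apply: le_trans (ereal_sup_ubound _); last first.
  by exists (r, w r); [apply: Ar; rewrite mulr1 addr_ge0// ltW|reflexivity].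
by rewrite /dini_quotient/= mulr1 -EFinB lee_fin.
Unshelve. all: by end_near. Qed.

(** A lower bound on the lower derivative is an eventual lower bound on the
    quotients, in particular along the times at which [w] comes back close to the
    cluster point [v]. *)
Lemma lower_dini_cluster (w : R -> 'rV[R]_n) (v : 'rV[R]_n) (c e : R)
    (N : set 'rV[R]_n) (P : set R) :
  (c%:E <= lower_dini Phi tau z 1 v)%E -> cluster (w @ 0^'+) v -> 0 < e ->
  nbhs v N -> (\forall r \near 0^'+, P r) ->
  exists r, [/\ P r, N (w r) & c - e <= q r (w r)].
Proof.
rewrite /lower_dini limf_einfE => cl wv e0 vN nP.
have : ((c - e)%:E < ereal_sup [set ereal_inf (dini_quotient Phi tau z 1 @` V) |
    V in dini_filter tau 1 v])%E.
  by apply: lt_le_trans cl; rewrite lte_fin ltrBlDr ltrDl.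
move=> /ereal_sup_gt[_ [A FA <-] cA].
have [[Q1 Q2] /= [nQ1 nQ2] QA] := FA.
have [_ [[r [rP [rQ1 r0]] <-] [Nw Q2w]]] :
    (w @` (P `&` (Q1 `&` [set r | 0 < r]))) `&` (N `&` Q2) !=set0.
  apply: wv; last exact: filterI.
  apply: (filterS (P := P `&` (Q1 `&` [set r | 0 < r]))) => [r Pr|]; first by exists r.
  by apply: filterI => //; apply: filterI => //; exact: nbhs_right_gt.
exists r; split=> //.
rewrite -lee_fin; apply: le_trans (ltW cA) _.
apply: le_trans (ereal_inf_lbound _) _.
  exists (r, w r); last reflexivity.
  by apply: (QA (r, w r)) => //=; rewrite mulr1 addr_ge0// ltW.
by rewrite /dini_quotient/= mulr1.
Qed.

End DiniAlongCurves.

(** * Discounted costs *)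

Section DiscountedCost.
Variables (R : realType) (n m : nat).
Variables (F : R -> 'rV[R]_n -> 'rV[R]_m -> 'rV[R]_n).
Variables (L : R -> 'rV[R]_n -> 'rV[R]_m -> R) (Omega : set 'rV[R]_m).
Variables (delta K1 K2 : R).
Hypotheses (K1_gt0 : 0 < K1) (K2_gt0 : 0 < K2) (K1_delta : K1 < delta).
Hypothesis F_continuous :
  continuous (fun p : R * 'rV[R]_n * 'rV[R]_m => F p.1.1 p.1.2 p.2).
Hypothesis F_lip : forall t u, Omega u -> forall x z,
  enorm (F t x u - F t z u) <= K1 * enorm (x - z).
Hypothesis F_growth : forall t x u, Omega u -> enorm (F t x u) <= K2 + K1 * enorm x.
Hypothesis L_continuous :
  continuous (fun p : R * 'rV[R]_n * 'rV[R]_m => L p.1.1 p.1.2 p.2).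
Hypothesis L_lip : forall t u, Omega u -> forall x z,
  `|L t x u - L t z u| <= expR (- delta * t) * (K1 * enorm (x - z)).
Hypothesis L_growth : forall t x u, Omega u ->
  `|L t x u| <= expR (- delta * t) * (K2 + K1 * enorm x).
Implicit Types (x y : R -> 'rV[R]_n) (u v : R -> 'rV[R]_m) (tau t s T : R).
Local Notation mu := (@lebesgue_measure R).
Local Notation control := (control Omega).
Local Notation trajectory := (trajectory F).

Definition payoff tau x u : R := \int[mu]_(s in `[tau, +oo[) L s (x s) (u s).

Let K1n : K1 != 0. Proof. exact: lt0r_neq0. Qed.
Let gap0 : 0 < delta - K1. Proof. by rewrite subr_gt0. Qed.
Let growth0 (z : 'rV[R]_n) : 0 <= enorm z + K2 / K1.
Proof. by rewrite addr_ge0 ?enorm_ge0// divr_ge0// ltW. Qed.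

Lemma lbm_running u x : control u -> lbmv x -> lbm (fun s => L s (x s) (u s)).
Proof.
move=> [uO mu] lx.
apply: (@lbm_le _ _ (fun s => expR (- delta * (s - 0)) * (K2 + K1 * enorm (x s)))).
- pose G (p : R * 'rV[R]_n * 'rV[R]_m) := L p.1.1 p.1.2 p.2.
  by apply: (@measurable_along_curves _ _ _ G) => // i; have [] := lx i.
- apply: lbmM; first exact: lbm_expR.
  by apply: lbmD; [exact: lbm_cst|apply: lbmZ; exact: lbm_enorm].
- by move=> s; rewrite subr0; exact: L_growth.
Qed.

(** The growth rate K1 of the state is absorbed by the discount rate delta. *)
Lemma running_decay tau z u x s : control u -> trajectory tau z u x -> tau <= s ->
  `|L s (x s) (u s)| <= K1 * (enorm z + K2 / K1) * expR (- delta * tau) *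
    expR (- (delta - K1) * (s - tau)).
Proof.
move=> cu tx ts; have [uO _] := cu.
apply: le_trans (L_growth _ _ (uO s)) _.
have -> : K2 + K1 * enorm (x s) = K1 * (enorm (x s) + K2 / K1) by field.
have := trajectory_growth K1_gt0 F_continuous F_growth cu tx ts => h.
have -> : K1 * (enorm z + K2 / K1) * expR (- delta * tau) *
    expR (- (delta - K1) * (s - tau)) =
    expR (- delta * s) * (K1 * ((enorm z + K2 / K1) * expR (K1 * (s - tau)))).
  rewrite [RHS]mulrC -!mulrA -!expRD; do 2!congr (_ * _); congr expR; ring.
by rewrite ler_pM2l ?expR_gt0// ler_pM2l.
Qed.

Lemma payoff_integrable tau z u x : control u -> trajectory tau z u x ->
  mu.-integrable `[tau, +oo[ (EFin \o (fun s => L s (x s) (u s))) /\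
  `|payoff tau x u| <=
    K1 * (enorm z + K2 / K1) * expR (- delta * tau) / (delta - K1).
Proof.
move=> cu tx; apply: integrable_exp_decay gap0 _ _.
  by apply: lbm_running => //; have [] := tx.
by move=> s ts; apply: running_decay tx ts.
Qed.

Lemma payoff_lip tau z z' u x y : control u -> trajectory tau z u x ->
  trajectory tau z' u y ->
  `|payoff tau x u - payoff tau y u| <=
    K1 * enorm (z - z') * expR (- delta * tau) / (delta - K1).
Proof.
move=> cu tx ty.
have [ix _] := payoff_integrable cu tx.
have [iy _] := payoff_integrable cu ty.
rewrite /payoff -RintegralB//.
have [[lx _] [ly _]] := (tx, ty).
have lxy : lbm (fun s => L s (x s) (u s) - L s (y s) (u s)).
  by apply: lbmB; exact: lbm_running.
have [|_ //] := @integrable_exp_decay _ (fun s => L s (x s) (u s) - L s (y s) (u s)) tau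
  (K1 * enorm (z - z') * expR (- delta * tau)) _ gap0 lxy.
move=> s ts.
have [uO _] := cu; apply: le_trans (L_lip _ (uO s) _ _) _.
have := trajectory_lip K1_gt0 F_continuous F_lip F_growth cu tx ty ts => h.
have -> : K1 * enorm (z - z') * expR (- delta * tau) *
    expR (- (delta - K1) * (s - tau)) =
    expR (- delta * s) * (K1 * (enorm (z - z') * expR (K1 * (s - tau)))).
  rewrite [RHS]mulrC -!mulrA -!expRD; do 2!congr (_ * _); congr expR; ring.
by rewrite ler_pM2l ?expR_gt0// ler_pM2l.
Qed.

Lemma payoff_split tau T z u x : control u -> trajectory tau z u x -> tau <= T ->
  payoff tau x u = integ tau T (fun s => L s (x s) (u s)) + payoff T x u.
Proof.
move=> cu tx tT; have [ix _] := payoff_integrable cu tx.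
have := @Rintegral_itvB _ _ (BLeft tau) +oo%O T ix.
rewrite bnd_simp => /(_ tT isT) /eqP; rewrite subr_eq => /eqP h.
rewrite /payoff h addrC Rintegral_itv_obnd_cbnd//.
by apply: integrableS ix => //; apply: subset_itvr; rewrite bnd_simp.
Qed.

Lemma payoff_concat T z u v x y : control u -> control v -> lbmv x ->
  trajectory T z v y ->
  payoff T (concat T x y) (concat T u v) = payoff T y v.
Proof.
move=> cu cv lx ty; have [iy _] := payoff_integrable cv ty.
rewrite /payoff -[RHS]Rintegral_itv_obnd_cbnd; last first.
  by apply: integrableS iy => //; apply: subset_itvr; rewrite bnd_simp.
rewrite -Rintegral_itv_obnd_cbnd.
  apply: eq_Rintegral => s; rewrite inE/= in_itv/= andbT => Ts.
  by rewrite /concat leNgt Ts.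
apply: eq_integrable (_ : mu.-integrable `]T, +oo[ (EFin \o (fun s => L s (y s) (v s)))) => //.
  move=> s; rewrite inE/= in_itv/= andbT => Ts.
  by rewrite /concat leNgt Ts.
by apply: integrableS iy => //; apply: subset_itvr; rewrite bnd_simp.
Qed.

(** * The value function: dynamic programming, regularity and Dini inequalities *)

(** The value function enters through two properties only, those of an infimum: it
    is a lower bound of the payoffs, and it is approached by them. *)
Section ValueFunction.
Variable Phi : R -> 'rV[R]_n -> R.
Hypothesis Phi_le : forall tau z u x, 0 <= tau -> control u -> trajectory tau z u x ->
  Phi tau z <= payoff tau x u.
Hypothesis Phi_opt : forall tau z (e : R), 0 <= tau -> 0 < e -> exists u x,
  [/\ control u, trajectory tau z u x & payoff tau x u <= Phi tau z + e].

Lemma dynamic_programming_le tau T z u x : 0 <= tau -> tau <= T -> control u ->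
  trajectory tau z u x ->
  Phi tau z <= integ tau T (fun s => L s (x s) (u s)) + Phi T (x T).
Proof.
move=> tau0 tT cu tx; apply/ler_addgt0Pr => e e0.
have [v [y [cv ty yv]]] := Phi_opt (x T) (le_trans tau0 tT) e0.
have tc := trajectory_concat F_continuous F_growth tT cu cv tx ty.
have cc := control_concat T cu cv.
apply: le_trans (Phi_le tau0 cc tc) _.
rewrite (payoff_split cc tc tT) (payoff_concat cu cv (proj1 tx) ty) -addrA.
apply: lerD yv; rewrite le_eqVlt; apply/orP; left; apply/eqP.
by apply: eq_integ => s /andP[_ sT]; rewrite /concat sT.
Qed.

Lemma dynamic_programming_opt tau T z e : 0 <= tau -> tau <= T -> 0 < e ->
  exists u x, [/\ control u, trajectory tau z u x &
    integ tau T (fun s => L s (x s) (u s)) + Phi T (x T) <= Phi tau z + e].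
Proof.
move=> tau0 tT e0; have [u [x [cu tx xu]]] := Phi_opt z tau0 e0.
exists u, x; split=> //; apply: le_trans xu.
rewrite (payoff_split cu tx tT) lerD2l.
apply: Phi_le => //; first exact: le_trans tau0 tT.
exact: (trajectory_restrict F_continuous F_growth cu tT tx).
Qed.

Let discount_le1 tau : 0 <= tau -> expR (- delta * tau) <= 1.
Proof.
move=> tau0; rewrite -expR0 ler_expR mulNr oppr_le0 mulr_ge0//.
by rewrite ltW// (lt_trans K1_gt0).
Qed.

Lemma value_lip tau z z' : 0 <= tau ->
  `|Phi tau z - Phi tau z'| <= K1 / (delta - K1) * enorm (z - z').
Proof.
move=> tau0.
suff lip a b : Phi tau a - Phi tau b <= K1 / (delta - K1) * enorm (a - b).
  rewrite ler_norml lip andbT lerNl opprB; apply: le_trans (lip _ _) _.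
  by rewrite enorm_distC.
apply/ler_addgt0Pr => e e0.
have [u [y [cu ty yu]]] := Phi_opt b tau0 e0.
have [x tx] := trajectory_exists K1_gt0 K2_gt0 F_continuous F_lip F_growth tau a cu.
have h1 := Phi_le tau0 cu tx.
have := payoff_lip cu tx ty; rewrite ler_norml => /andP[_ h2].
have h3 : K1 * enorm (a - b) * expR (- delta * tau) / (delta - K1) <=
    K1 / (delta - K1) * enorm (a - b).
  rewrite mulrAC (mulrAC K1) ler_piMr ?discount_le1//.
  by rewrite mulr_ge0 ?enorm_ge0// divr_ge0// ltW.
lra.
Qed.

Lemma running_integral_short tau z u x T : 0 <= tau -> tau <= T <= tau + 1 ->
  control u -> trajectory tau z u x ->
  `|integ tau T (fun s => L s (x s) (u s))| <=
  K1 * (enorm z + K2 / K1) * (T - tau).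
Proof.
move=> tau0 /andP[tT T1] cu tx.
have lL := lbm_running cu (proj1 tx).
apply: le_trans (normr_integ _ _ lL) _.
apply: ler_integ_cst => //; first exact: lbm_norm.
move=> s /andP[ts _]; apply: le_trans (running_decay cu tx ts) _.
have c0 : 0 <= K1 * (enorm z + K2 / K1) by rewrite mulr_ge0// ltW.
rewrite -mulrA ler_piMr// -expRD -expR0 ler_expR.
have : 0 <= delta * tau by rewrite mulr_ge0// ltW// (lt_trans K1_gt0).
have : 0 <= (delta - K1) * (s - tau) by rewrite mulr_ge0 ?subr_ge0// ltW.
lra.
Qed.

(** Over [a, b] any process moves the state and accumulates cost at most
    proportionally to b - a.  The dynamic programming principle compares the
    value at (a, z) with that at (b, x b), and [value_lip] brings x b back to z. *)
Lemma value_time_lip a b z : 0 <= a -> a <= b <= a + 1 ->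
  `|Phi a z - Phi b z| <=
  K1 * (enorm z + K2 / K1) * (1 + K1 / (delta - K1) * expR K1) * (b - a).
Proof.
move=> a0 ab1; have [ab _] := andP ab1; have b0 := le_trans a0 ab.
have bound u x : control u -> trajectory a z u x ->
    `|integ a b (fun s => L s (x s) (u s)) + (Phi b (x b) - Phi b z)| <=
    K1 * (enorm z + K2 / K1) * (1 + K1 / (delta - K1) * expR K1) * (b - a).
  move=> cu tx; apply: le_trans (ler_normD _ _) _.
  have h1 := running_integral_short a0 ab1 cu tx.
  have h2 := value_lip (x b) z b0.
  have h3 := trajectory_displacement K1_gt0 K2_gt0 F_continuous F_growth cu tx ab1.
  have k0 : 0 <= K1 / (delta - K1) by rewrite divr_ge0// ltW.
  have h4 := ler_wpM2l k0 h3.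
  lra.
rewrite ler_norml; apply/andP; split; last first.
  apply/ler_addgt0Pr => e e0.
  have [u [x [cu tx _]]] := Phi_opt z a0 e0.
  have := dynamic_programming_le a0 ab cu tx.
  have := bound _ _ cu tx; rewrite ler_norml => /andP[_]; lra.
rewrite lerNl opprB; apply/ler_addgt0Pr => e e0.
have [u [x [cu tx]]] := dynamic_programming_opt z a0 ab e0.
have := bound _ _ cu tx; rewrite ler_norml => /andP[+ _]; lra.
Qed.

Lemma value_continuous :
  {within [set p : R * 'rV[R]_n | 0 <= p.1], continuous (fun p => Phi p.1 p.2)}.
Proof.
apply/subspace_continuousP => -[tau z] /= tau0.
pose C1 := K1 / (delta - K1).
pose C2 := K1 * (enorm z + K2 / K1) * (1 + C1 * expR K1).
have C10 : 0 <= C1 by rewrite divr_ge0// ltW.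
have C20 : 0 <= C2.
  apply: mulr_ge0; first by apply: mulr_ge0; [exact: ltW|exact: growth0].
  by rewrite addr_ge0// mulr_ge0// expR_ge0.
have lip s w : 0 <= s -> `|tau - s| <= 1 ->
    `|Phi tau z - Phi s w| <= C1 * n%:R * `|z - w| + C2 * `|tau - s|.
  move=> s0 s1; have -> : Phi tau z - Phi s w = (Phi s z - Phi s w) + (Phi tau z - Phi s z).
    by ring.
  apply: le_trans (ler_normD _ _) _; apply: lerD.
    apply: le_trans (value_lip _ _ s0) _; rewrite -[leRHS]mulrA ler_wpM2l//.
    exact: ler_enorm_mxnorm.
  have [st|ts] := leP s tau.
    rewrite distrC (ger0_norm (_ : 0 <= tau - s)) ?subr_ge0//; apply: value_time_lip => //.
    by rewrite st/=; move: s1; rewrite ger0_norm ?subr_ge0//; lra.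
  rewrite (distrC tau) (gtr0_norm (_ : 0 < s - tau)) ?subr_gt0//; apply: value_time_lip => //.
  by rewrite ltW//=; move: s1; rewrite distrC gtr0_norm ?subr_gt0//; lra.
apply/cvgrPdist_le => /= e e0.
have D0 : 0 < 2 * (C1 * n%:R + C2 + 1).
  by rewrite mulr_gt0// ltr_wpDl// addr_ge0// mulr_ge0.
pose d := Num.min 1 (e / (2 * (C1 * n%:R + C2 + 1))).
have d0 : 0 < d by rewrite lt_min ltr01 divr_gt0.
near=> p.
have p0 : 0 <= p.1 by near: p; exact: withinT.
have [p1 p2] : ball (tau, z) d p.
  by near: p; apply: cvg_within; exact: nbhsx_ballx.
have p1' : `|tau - p.1| <= d by exact: ltW.
have p2' : `|z - p.2| <= d by apply: ltW; move: p2; rewrite mx_norm_ball.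
apply: le_trans (lip _ _ p0 (le_trans p1' _)) _; first by rewrite ge_min lexx.
have d2 : d <= e / (2 * (C1 * n%:R + C2 + 1)) by rewrite ge_min lexx orbT.
have h1 : C1 * n%:R * `|z - p.2| <= C1 * n%:R * d by rewrite ler_wpM2l// mulr_ge0.
have h2 : C2 * `|tau - p.1| <= C2 * d by rewrite ler_wpM2l.
move: d2; rewrite ler_pdivlMr// => d2; lra.
Unshelve. all: by end_near. Qed.

Lemma value_bound tau z : 0 <= tau ->
  `|Phi tau z| <= K1 * (enorm z + K2 / K1) / (delta - K1) * expR (- delta * tau).
Proof.
move=> tau0; set B := (X in _ <= X).
have bound u x : control u -> trajectory tau z u x -> `|payoff tau x u| <= B.
  by move=> cu tx; have [_] := payoff_integrable cu tx; rewrite /B mulrAC.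
rewrite ler_norml; apply/andP; split.
  apply/ler_addgt0Pr => e e0; have [u [x [cu tx ux]]] := Phi_opt z tau0 e0.
  have := bound _ _ cu tx; rewrite ler_norml => /andP[+ _]; lra.
have [u [x [cu tx _]]] := Phi_opt z tau0 ltr01.
have := bound _ _ cu tx; rewrite ler_norml => /andP[_]; apply: le_trans.
exact: Phi_le.
Qed.

Lemma value_vanishes (K : set 'rV[R]_n) : compact K ->
  {uniform K, Phi @ +oo --> (fun=> 0)}.
Proof.
move=> /compact_bounded [M0 [_ /(_ (M0 + 1))]]; rewrite ltrDl ltr01 => /(_ isT) KM.
set M := M0 + 1 in KM.
move=> P /uniform_nbhs [E [entE EP]].
move: entE; rewrite -entourage_ballE => -[e /= e0 eE].
pose B := K1 * (n%:R * `|M| + K2 / K1) / (delta - K1).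
have delta0 : 0 < delta by rewrite (lt_trans K1_gt0).
have B0 : 0 <= B.
  apply: divr_ge0; last exact: ltW.
  apply: mulr_ge0; first exact: ltW.
  by apply: addr_ge0; [rewrite mulr_ge0|rewrite divr_ge0// ltW].
apply: (filterS (P := [set t | B / e / delta < t])) => [t /= Bt|]; last first.
  by apply: nbhs_pinfty_gt; exact: num_real.
have t0 : 0 < t by apply: le_lt_trans Bt; rewrite divr_ge0 ?(ltW delta0)// divr_ge0// ltW.
apply: EP => y Ky; apply: eE; rewrite /ball/= sub0r normrN.
apply: le_lt_trans (value_bound _ (ltW t0)) _.
have yB : K1 * (enorm y + K2 / K1) / (delta - K1) <= B.
  rewrite ler_pM2r ?invr_gt0// ler_pM2l// lerD2r.
  apply: le_trans (ler_enorm_mxnorm _) _; rewrite ler_wpM2l//.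
  exact: le_trans (KM _ Ky) (ler_norm _).
apply: le_lt_trans (ler_wpM2r (expR_ge0 _) yB) _.
rewrite mulNr expRN ltr_pdivrMr ?expR_gt0//.
have : e * (1 + delta * t) <= e * expR (delta * t).
  by rewrite ler_pM2l// expR_ge1Dx.
move: Bt; rewrite ltr_pdivrMr// ltr_pdivrMr//; lra.
Qed.

(** The curve is the trajectory of the constant control [a]; its chords from [z],
    divided by r, tend to F tau z a because its velocity is continuous from the
    right at [tau]. *)
Lemma value_supergradient tau (z : 'rV[R]_n) (g : R * 'rV[R]_n) (a : 'rV[R]_m) :
  0 <= tau -> Omega a ->
  dini_supergradient Phi tau z g ->
  0 <= g.1 + dotv g.2 (F tau z a) + L tau z a.
Proof.
move=> tau0 uO gsup; pose uc : R -> 'rV[R]_m := fun=> a.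
have cu : control uc by split=> // j; exact: measurable_cst.
have [x tx] := trajectory_exists K1_gt0 K2_gt0 F_continuous F_lip F_growth tau z cu.
have [lx xE] := tx.
have xtau : x tau = z by rewrite xE// vinteg_point addr0.
have xz : x s @[s --> tau^'+] --> z.
  pose C := K1 * (enorm z + K2 / K1) * expR K1.
  have C0 : 0 <= C by rewrite mulr_ge0 ?expR_ge0// mulr_ge0// ltW.
  apply/cvgrPdist_le => e e0; near=> s.
  apply: le_trans (ler_mxnorm_enorm _) _; rewrite enorm_distC.
  have ts : tau < s by near: s; exact: nbhs_right_gt.
  have s1 : s - tau <= 1 by apply: ltW; near: s; exact: nbhs_right_ltDr.
  have se : s - tau < e / (C + 1).
    by near: s; apply: nbhs_right_ltDr; rewrite divr_gt0// ltr_wpDl.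
  apply: le_trans (trajectory_displacement K1_gt0 K2_gt0 F_continuous F_growth cu tx _) _.
    by rewrite (ltW ts)/=; lra.
  rewrite -/C; move: se; rewrite ltr_pdivlMr ?ltr_wpDl// => se.
  have : 0 < s - tau by rewrite subr_gt0.
  lra.
have along (V : topologicalType) (G : R * 'rV[R]_n * 'rV[R]_m -> V) : continuous G ->
    G (s, x s, a) @[s --> tau^'+] --> G (tau, x tau, a).
  move=> cG; rewrite xtau; apply: (@cvg_comp _ _ _ (fun s => (s, x s, a)) G); last exact: cG.
  apply: (@cvg_pair _ _ _ _ (nbhs (tau, z)) (nbhs a) _ _ _ (fun s => (s, x s))).
    by apply: (@cvg_pair _ _ _ _ (nbhs tau) (nbhs z)) => //; exact: cvg_within.
  exact: cvg_cst.
have lF := lbmv_dynamics F_continuous F_growth cu lx.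
have lL := lbm_running cu lx.
pose w r := r^-1 *: vinteg tau (tau + r) (fun s => F s (x s) a).
have wF : w r @[r --> 0^'+] --> F tau z a.
  apply: cvg_rowP => i; rewrite -xtau.
  have Fcvg := along _ _ F_continuous.
  have ci : F s (x s) a 0 i @[s --> tau^'+] --> F tau (x tau) a 0 i.
    by apply: (@cvg_comp _ _ _ (fun s => F s (x s) a) (fun v : 'rV[R]_n => v 0 i));
      [exact: Fcvg|exact: coord_continuous].
  rewrite (_ : (fun r => _) = (fun r => r^-1 * integ tau (tau + r) (fun s => F s (x s) a 0 i))).
    exact: average_cvg (lF i) ci.
  by apply/funext => r; rewrite !mxE.
have LF := average_cvg lL (along _ _ L_continuous).
have : ((- L tau z a)%:E <= upper_dini Phi tau z 1 (F tau z a))%E.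
  apply: (upper_dini_ge tau0 wF) => e e0; near=> r.
  have r0 : 0 < r by near: r; exact: nbhs_right_gt.
  have tr : tau <= tau + r by rewrite lerDl ltW.
  have := dynamic_programming_le tau0 tr cu tx.
  rewrite {1}xE// -/uc => h.
  rewrite /w scalerA divff ?lt0r_neq0// scale1r ler_pdivlMr//.
  have : r^-1 * integ tau (tau + r) (fun s => L s (x s) (uc s)) < L tau (x tau) (uc tau) + e.
    by near: r; apply: (cvgr_lt _ LF); rewrite ltrDl.
  rewrite mulrC ltr_pdivrMr// xtau /uc => h2.
  rewrite -/uc in h h2 *; lra.
move=> /le_trans/(_ (gsup _ _)); rewrite lee_fin mul1r dotvC; lra.
Unshelve. all: by end_near. Qed.

(** If the left-hand side were at least [eta] on all of [Omega], r^2-optimal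
    processes would have a mean velocity and a mean running cost that violate the
    subgradient inequality at a cluster point of the mean velocities. *)
Lemma value_subgradient tau (z : 'rV[R]_n) (g : R * 'rV[R]_n) (eta : R) :
  0 <= tau -> 0 < eta -> compact Omega -> dini_subgradient Phi tau z g ->
  exists2 a, Omega a & g.1 + dotv g.2 (F tau z a) + L tau z a < eta.
Proof.
move=> tau0 eta0 cO gsub; apply: contrapT => no.
pose G (p : R * 'rV[R]_n * 'rV[R]_m) :=
  g.1 + dotv g.2 (F p.1.1 p.1.2 p.2) + L p.1.1 p.1.2 p.2.
have cG : continuous G.
  move=> p; apply: cvgD; last exact: L_continuous.
  apply: cvgD; first exact: cvg_cst.
  apply: (@cvg_comp _ _ _ (fun p : R * 'rV[R]_n * 'rV[R]_m => F p.1.1 p.1.2 p.2)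
    (dotv g.2)); first exact: F_continuous.
  exact: continuous_dotv.
have Geta a : Omega a -> eta <= G (tau, z, a).
  by move=> Oa; rewrite leNgt; apply/negP => h; apply: no; exists a.
(* Tube lemma: G exceeds eta / 2 near the compact set of all (tau, z, a). *)
have : \forall p \near (tau, z), Omega `<=` [set a | eta / 2 < G (p, a)].
  apply: ((compact_near_coveringP Omega).1 cO _ (nbhs (tau, z))
    (fun p a => eta / 2 < G (p, a))) => a Oa.
  have : \forall q \near (tau, z, a), eta / 2 < G q.
    by apply: (cvgr_gt _ (cG (tau, z, a))); have := Geta _ Oa; lra.
  move=> [[A B] [/= nA nB] AB].
  by exists (B, A) => // -[b p] [/= Bb Ap]; exact: (AB (p, b)).
move=> /nbhs_ballP[d /= d0 Gd].
pose C := K1 * (enorm z + K2 / K1) * expR K1.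
have C0 : 0 <= C by rewrite mulr_ge0 ?expR_ge0// mulr_ge0// ltW.
(* For r <= 0 the pair is irrelevant and set to a dummy value. *)
have /choice[ux uxP] : forall r : R, exists ux : (R -> 'rV[R]_m) * (R -> 'rV[R]_n),
    0 < r -> [/\ control ux.1, trajectory tau z ux.1 ux.2 &
    integ tau (tau + r) (fun s => L s (ux.2 s) (ux.1 s)) +
      Phi (tau + r) (ux.2 (tau + r)) <= Phi tau z + r * r].
  move=> r; have [r0|r0] := ltP 0 r; last by exists (fun=> 0, fun=> 0).
  have tr : tau <= tau + r by rewrite lerDl ltW.
  have [u [x ?]] := dynamic_programming_opt z tau0 tr (mulr_gt0 r0 r0).
  by exists (u, x).
pose w r := r^-1 *: vinteg tau (tau + r) (fun s => F s ((ux r).2 s) ((ux r).1 s)).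
have zw r : 0 < r -> z + r *: w r = (ux r).2 (tau + r).
  move=> r0; have [_ [_ xE] _] := uxP r r0.
  rewrite xE; last by rewrite lerDl ltW.
  by rewrite /w scalerA divff ?lt0r_neq0// scale1r.
have near1 : \forall r \near (0 : R)^'+, r <= 1 by exact: nbhs_right_le.
have wbounded : \forall r \near (0 : R)^'+, [set v : 'rV[R]_n | `|v| <= C] (w r).
  near=> r; have r0 : 0 < r by near: r; exact: nbhs_right_gt.
  have r1 : r <= 1 by near: r.
  have [cu tx _] := uxP r r0; rewrite /=.
  have := trajectory_displacement K1_gt0 K2_gt0 F_continuous F_growth cu tx.
  move=> /(_ (tau + r)); rewrite -zw// lerDl lerD2l ltW// => /(_ r1).
  rewrite (addrC z) addrK (addrC tau) addrK enormZ gtr0_norm// mulrC ler_pM2r//.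
  by apply: le_trans; exact: ler_mxnorm_enorm.
have : compact [set v : 'rV[R]_n | `|v| <= C].
  apply: bounded_closed_compact.
    by exists C; split=> [|M CM v /= vC]; [exact: num_real|rewrite (le_trans vC)// ltW].
  apply: (@preimage_closed _ _ (fun v : 'rV[R]_n => `|v|) [set y | y <= C]) => [v _|].
    exact: norm_continuous.
  exact: closed_le.
move=> /(_ (w @ 0^'+) _ wbounded)[v [_ clv]].
have := gsub 1 v; rewrite mul1r => gv.
have e8 : 0 < eta / 8 by rewrite divr_gt0.
have nN : \forall y \near v, dotv g.2 y < dotv g.2 v + eta / 8.
  by apply: (@cvgr_lt _ _ (nbhs v) _ (dotv g.2) (dotv g.2 v)
    (@continuous_dotv _ _ g.2 v)); rewrite ltrDl.
(* r <= eta / 8 absorbs the optimality defect r^2 / r; the last two bounds keep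
   (s, x s) within distance d of (tau, z) for s <= tau + r. *)
pose dr := Num.min (Num.min 1 (eta / 8)) (Num.min (d / 2) (d / (2 * (C + 1)))).
have dr0 : 0 < dr.
  by rewrite !lt_min ltr01 e8 !divr_gt0// mulr_gt0// ltr_wpDl.
have nP : \forall r \near (0 : R)^'+, 0 < r /\ r <= dr.
  near=> r; split; near: r; [exact: nbhs_right_gt|exact: nbhs_right_le].
have [r [[r0 rdr] /= rN]] := lower_dini_cluster tau0 gv clv e8 nN nP.
move: rdr; rewrite !le_min => /andP[/andP[r1 r8] /andP[rd rC]].
have [cu tx opt] := uxP r r0.
have [[lx xE] [uO _]] := (tx, cu).
have tr : tau <= tau + r by rewrite lerDl ltW.
have lF := lbmv_dynamics F_continuous F_growth cu lx.
have lL := lbm_running cu lx.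
have ldF : lbm (fun s => dotv g.2 (F s ((ux r).2 s) ((ux r).1 s))).
  by apply: lbm_dotv => //; exact: lbmv_cst.
(* The inequality eta / 2 < G, integrated along the r^2-optimal process. *)
have avg : eta / 2 * r <= r * (g.1 + dotv g.2 (w r)) +
    integ tau (tau + r) (fun s => L s ((ux r).2 s) ((ux r).1 s)).
  have -> : eta / 2 * r = integ tau (tau + r) (fun=> eta / 2).
    by rewrite integ_cst//; ring.
  have -> : r * (g.1 + dotv g.2 (w r)) = integ tau (tau + r) (fun=> g.1) +
      integ tau (tau + r) (fun s => dotv g.2 (F s ((ux r).2 s) ((ux r).1 s))).
    rewrite integ_cst// -dotv_vinteg// /w (dotvC g.2) dotvZl (dotvC g.2).
    by field; rewrite lt0r_neq0.
  have l1 : lbm (fun s => g.1 + dotv g.2 (F s ((ux r).2 s) ((ux r).1 s))).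
    by apply: lbmD => //; exact: lbm_cst.
  rewrite -integD//; last exact: lbm_cst.
  rewrite -integD//; apply: ler_integ.
  - exact: lbm_cst.
  - exact: lbmD.
  move=> s /andP[ts sr]; apply: ltW.
  apply: (Gd (s, (ux r).2 s)); last exact: uO.
  have st : s - tau <= r by lra.
  split=> /=.
    by rewrite /ball/= distrC ger0_norm ?subr_ge0//; lra.
  rewrite mx_norm_ball /ball_ /= distrC; apply: le_lt_trans (ler_mxnorm_enorm _) _.
  apply: le_lt_trans (trajectory_displacement K1_gt0 K2_gt0 F_continuous F_growth cu tx _) _.
    by rewrite ts/=; lra.
  rewrite -/C; move: rC; rewrite ler_pdivlMr ?mulr_gt0 ?ltr_wpDl// => rC.
  have : C * (s - tau) <= C * r by rewrite ler_wpM2l.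
  have : 0 <= C * r by rewrite mulr_ge0// ltW.
  lra.
rewrite zw// ler_pdivlMr// (dotvC v) => low.
have : r * r <= eta / 8 * r by rewrite ler_pM2r.
have : r * dotv g.2 (w r) <= r * (dotv g.2 v + eta / 8) by rewrite ler_pM2l// ltW.
have : 0 < eta * r by rewrite mulr_gt0.
lra.
Unshelve. all: by end_near. Qed.

End ValueFunction.
End DiscountedCost.

(** * Reduction to data defined at all times *)

Lemma continuous_within_comp (T U V : topologicalType) (A : set U) (g : U -> V) (h : T -> U) :
  {within A, continuous g} -> continuous h -> (forall p, A (h p)) ->
  continuous (fun p => g (h p)).
Proof.
move=> /subspace_continuousP cg ch hA p B nB.
have gB : nbhs (h p) [set q | A q -> B (g q)] := cg _ (hA p) B nB.
have : nbhs p (h @^-1` [set q | A q -> B (g q)]) := ch p _ gB.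
by apply: filterS => q; apply.
Qed.

Lemma primitive_abs_continuous (R : realType) n (a b : R) (x G : R -> 'rV[R]_n) : lbmv G ->
  (forall s t, a <= s -> s <= t -> x t - x s = vinteg s t G) ->
  abs_continuous a b x.
Proof.
move=> lG xG e e0.
have [_ /(_ (`|a| + `|b|))[M0 GM]] := lbm_enorm lG.
pose M := Num.max 0 M0; have M_ge0 : 0 <= M by rewrite le_max lexx.
exists (e / (M + 1)) => [|N c c' cc' _]; first by rewrite divr_gt0// ltr_wpDl.
rewrite ltr_pdivlMr ?ltr_wpDl// => small.
have cc i : 0 <= c' i - c i by rewrite subr_ge0; have [] := cc' i.
have : \sum_(i < N) enorm (x (c' i) - x (c i)) <= M * \sum_(i < N) (c' i - c i).
  rewrite big_distrr/=; apply: ler_sum => i _; have [aci cci cbi] := cc' i.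
  rewrite xG//; apply: le_trans (enorm_vinteg _ _ lG) _.
  apply: ler_integ_cst => //; first exact: lbm_enorm.
  move=> s /andP[cs sc]; apply: le_trans (ler_norm _) _.
  apply: le_trans (GM s _) _; last by rewrite le_max lexx orbT.
  have := ler_norm (- a); have := ler_norm b; rewrite normrN => *.
  have := normr_ge0 a; have := normr_ge0 b => *.
  by rewrite ler_norml; lra.
have : 0 <= \sum_(i < N) (c' i - c i) by apply: sumr_ge0.
lra.
Qed.

(** Only the case of a single interval in the definition of absolute continuity is
    used. *)
Lemma abs_continuous_clamp (R : realType) n (tau : R) (x : R -> 'rV[R]_n) :
  loc_abs_continuous tau x ->
  continuous (fun t => x (Num.max tau t)).
Proof.
move=> ac t0; apply/cvgrPdist_lt => e e0.
pose T := Num.max tau t0 + 1.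
have tauT : tau <= T by rewrite /T (le_trans (_ : _ <= Num.max tau t0)) ?lerDl// le_max lexx.
have [d d0 acd] := ac T tauT e e0.
have close s t : tau <= s -> s <= t -> t <= T -> t - s < d -> enorm (x t - x s) < e.
  move=> ts st tT std; have := acd 1%N (fun=> s) (fun=> t).
  rewrite !big_ord1; apply => //.
  by move=> i j _ _ _; rewrite (ord1 i) (ord1 j).
have rho0 : 0 < Num.min 1 d by rewrite lt_min ltr01.
near=> t; apply: le_lt_trans (ler_mxnorm_enorm _) _.
have tt0 : `|t0 - t| < Num.min 1 d.
  by near: t; exact: (nbhsx_ballx t0 _ rho0).
move: tt0; rewrite lt_min => /andP[t1 td].
have lem a b : a <= b -> b - a < d -> b <= t0 + 1 ->
    enorm (x (Num.max tau b) - x (Num.max tau a)) < e.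
  move=> ab abd bt; apply: close.
  - by rewrite le_max lexx.
  - by rewrite ge_max !le_max lexx/= ab orbT.
  - rewrite ge_max tauT/= /T; apply: le_trans bt _; rewrite lerD2r.
    by rewrite le_max lexx orbT.
  - apply: le_lt_trans abd.
    rewrite lerBlDr ge_max; apply/andP; split.
      by apply: le_trans (_ : Num.max tau a <= _); [rewrite le_max lexx|rewrite lerDr subr_ge0].
    have : a <= Num.max tau a by rewrite le_max lexx orbT.
    lra.
move: t1 td; rewrite !ltr_norml => /andP[? ?] /andP[? ?].
have [h|h] := leP t t0; first by apply: lem => //; lra.
by rewrite enorm_distC; apply: lem; lra.
Unshelve. all: by end_near. Qed.

Section Reduction.
Variables (R : realType) (n m : nat).
Variables (l : R -> 'rV[R]_n -> 'rV[R]_m -> R).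
Variables (f : R -> 'rV[R]_n -> 'rV[R]_m -> 'rV[R]_n).
Variables (Omega : set 'rV[R]_m) (delta K1 K2 : R).
Hypotheses (hOmega : Omega !=set0) (hK1 : 0 < K1) (hK2 : 0 < K2).
Hypotheses (hA1 : assumption1 l f Omega K1) (hA2 : assumption2 l f Omega K2).
Hypotheses (hA3 : assumption3 l f) (hA5 : assumption5 Omega) (K1_delta : K1 < delta).
Local Notation mu := (@lebesgue_measure R).
Implicit Types tau t s T : R.

(** Clamping time keeps the bounds on f and l valid for all real t and makes the
    data continuous on the whole space; for t >= 0 nothing changes. *)
Let F t := f (Num.max 0 t).
Let L t x u := expR (- delta * t) * l (Num.max 0 t) x u.

Let max_ge0 t : 0 <= Num.max 0 t. Proof. by rewrite le_max lexx. Qed.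

Let FE t x u : 0 <= t -> F t x u = f t x u.
Proof. by move=> t0; rewrite /F max_r. Qed.

Let LE t x u : 0 <= t -> L t x u = expR (- (delta * t)) * l t x u.
Proof. by move=> t0; rewrite /L max_r// mulNr. Qed.

Let clamp_continuous :
  continuous (fun p : R * 'rV[R]_n * 'rV[R]_m => (Num.max 0 p.1.1, p.1.2, p.2)).
Proof.
move=> [[t x] u].
apply: (@cvg_pair _ _ _ _ (nbhs (Num.max 0 t, x)) (nbhs u) _ _ _
   (fun p : R * 'rV[R]_n * 'rV[R]_m => (Num.max 0 p.1.1, p.1.2)) (fun p => p.2)); last exact: cvg_snd.
apply: (@cvg_pair _ _ _ _ (nbhs (Num.max 0 t)) (nbhs x) _ _ _
   (fun p : R * 'rV[R]_n * 'rV[R]_m => Num.max 0 p.1.1) (fun p => p.1.2)); last first.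
  by apply: (@cvg_comp _ _ _ fst snd _ (nbhs (t, x))); [exact: cvg_fst|exact: cvg_snd].
apply: (@cvg_comp _ _ _ (fun p : R * 'rV[R]_n * 'rV[R]_m => p.1.1) (Num.max 0) _ (nbhs t)).
  by apply: (@cvg_comp _ _ _ fst fst _ (nbhs (t, x))); [exact: cvg_fst|exact: cvg_fst].
by apply: (@continuous_max _ _ (fun=> 0) id t); [exact: cvg_cst|exact: cvg_id].
Qed.

Let F_continuous : continuous (fun p : R * 'rV[R]_n * 'rV[R]_m => F p.1.1 p.1.2 p.2).
Proof. exact: (continuous_within_comp hA3.2 clamp_continuous (fun p => max_ge0 p.1.1)). Qed.

Let L_continuous : continuous (fun p : R * 'rV[R]_n * 'rV[R]_m => L p.1.1 p.1.2 p.2).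
Proof.
move=> p; apply: cvgM; last exact: (continuous_within_comp hA3.1 clamp_continuous (fun p => max_ge0 p.1.1)).
apply: (@cvg_comp _ _ _ (fun p : R * 'rV[R]_n * 'rV[R]_m => - delta * p.1.1) expR _
  (nbhs (- delta * p.1.1))); last exact: continuous_expR.
apply: cvgM; first exact: cvg_cst.
by case: p => [[t x] u]; apply: (@cvg_comp _ _ _ fst fst _ (nbhs (t, x))); exact: cvg_fst.
Qed.

Let F_lip t (u : 'rV[R]_m) : Omega u -> forall x z, enorm (F t x u - F t z u) <= K1 * enorm (x - z).
Proof.
move=> Ou x z; apply: le_trans (hA1 (max_ge0 t) Ou x z).
by rewrite lerDr.
Qed.

Let l_lip t (u : 'rV[R]_m) : 0 <= t -> Omega u -> forall x z,
  `|l t x u - l t z u| <= K1 * enorm (x - z).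
Proof.
by move=> t0 Ou x z; apply: le_trans (hA1 t0 Ou x z); rewrite lerDl enorm_ge0.
Qed.

Let at0 t (u : 'rV[R]_m) : 0 <= t -> Omega u -> `|l t 0 u| + enorm (f t 0 u) <= K2.
Proof. by move=> t0 /(hA2 0 t0); rewrite enorm0 addr0 mulr1. Qed.

(** Only the value at the state 0 is taken from the growth hypothesis; the Lipschitz
    condition does the rest.  The slope is thus K1, which is below delta, and not
    K2, which need not be. *)
Let F_growth t (x : 'rV[R]_n) (u : 'rV[R]_m) : Omega u -> enorm (F t x u) <= K2 + K1 * enorm x.
Proof.
move=> Ou; rewrite -(subrK (F t 0 u) (F t x u)) addrC.
apply: le_trans (ler_enormD _ _) _; apply: lerD.
  by apply: le_trans (at0 (max_ge0 t) Ou); rewrite lerDr.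
by have := F_lip t Ou x 0; rewrite subr0.
Qed.

Let L_lip t (u : 'rV[R]_m) : Omega u -> forall x z,
  `|L t x u - L t z u| <= expR (- delta * t) * (K1 * enorm (x - z)).
Proof.
move=> Ou x z; rewrite /L -mulrBr normrM gtr0_norm ?expR_gt0//.
by rewrite ler_pM2l ?expR_gt0//; exact: l_lip.
Qed.

Let L_growth t (x : 'rV[R]_n) (u : 'rV[R]_m) : Omega u ->
  `|L t x u| <= expR (- delta * t) * (K2 + K1 * enorm x).
Proof.
move=> Ou; rewrite /L normrM gtr0_norm ?expR_gt0// ler_pM2l ?expR_gt0//.
rewrite -(subrK (l (Num.max 0 t) 0 u) (l _ x u)) addrC.
apply: le_trans (ler_normD _ _) _; apply: lerD.
  by apply: le_trans (at0 (max_ge0 t) Ou); rewrite lerDl enorm_ge0.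
by have := l_lip (max_ge0 t) Ou x 0; rewrite subr0.
Qed.

(** The state is a primitive of a locally bounded function, hence locally absolutely
    continuous, and the cost converges absolutely by [payoff_integrable]. *)
Lemma trajectory_finite_cost tau z (u : R -> 'rV[R]_m) (x : R -> 'rV[R]_n) :
  0 <= tau -> control Omega u ->
  trajectory F tau z u x ->
  finite_cost_processes l f Omega delta tau z (x, u) /\
  cost l delta tau x u = (payoff L tau x u)%:E.
Proof.
move=> tau0 cu tx; have [[lx xE] [uO mu_]] := (tx, cu).
have [iL _] := payoff_integrable hK1 K1_delta F_continuous F_growth L_continuous L_growth cu tx.
have lF := lbmv_dynamics F_continuous F_growth cu lx.
have eqL s : s \in `[tau, +oo[%classic -> (EFin \o (fun s => L s (x s) (u s))) s = running_cost l delta x u s.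
  rewrite inE/= in_itv/= andbT => ts.
  by rewrite /running_cost LE//; exact: le_trans ts.
have ir : mu.-integrable `[tau, +oo[ (running_cost l delta x u).
  by apply: eq_integrable iL.
have costE : cost l delta tau x u = (payoff L tau x u)%:E.
  rewrite (_ : cost _ _ _ _ _ = (\int[mu]_(s in `[tau, +oo[) (L s (x s) (u s))%:E)%E).
    rewrite /payoff /Rintegral fineK//.
    exact: (integrable_fin_num _ iL).
  by apply: eq_integral => s ts; rewrite -eqL.
split=> //; split=> /=.
- split.
  + split; last by apply: aeW => s _; exact: uO.
    move=> T _ j; apply: (@lbm_integrable _ (fun t => u t 0 j)).
    have /compact_bounded[M0 [_ /(_ (M0 + 1))]] := hA5.
    rewrite ltrDl ltr01 => /(_ isT) OM; split=> // S; exists (m%:R * (M0 + 1)) => s _.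
    apply: le_trans (normr_coord_enorm _ _) _.
    by apply: le_trans (ler_enorm_mxnorm _) _; rewrite ler_wpM2l//; exact: OM.
  + move=> T tT; apply: (primitive_abs_continuous T lF) => s t ts st.
    rewrite (xE _ ts) (xE _ (le_trans ts st)) (vinteg_split lF ts st).
    by rewrite opprD addrACA subrr add0r addrAC subrr add0r.
  + move=> t tt i.
    have eqF s : s \in `[tau, t]%classic -> F s (x s) (u s) 0 i = f s (x s) (u s) 0 i.
      rewrite inE/= in_itv/= => /andP[ts _]; rewrite FE//; exact: le_trans ts.
    split.
      apply: eq_integrable (lbm_integrable tau t (lF i)) => // s ts /=.
      by rewrite eqF.
    by rewrite {1}xE// !mxE; congr (_ + _); apply: eq_Rintegral => s ts; rewrite eqF.
- left; have : (\int[mu]_(t in `[tau, +oo[) (running_cost l delta x u)^\+ t)%E \is a fin_num.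
    exact: integrable_pos_fin_num ir.
  by rewrite fin_numElt => /andP[].
- by rewrite costE ltry.
Qed.

Let ae_impl (P Q : R -> Prop) : (forall s, P s -> Q s) ->
  {ae mu, forall s, P s} -> {ae mu, forall s, Q s}.
Proof. exact: (@filterS _ _ (ae_filter_ringOfSetsType mu)). Qed.

(** [u0] extends [u] measurably to the times before [tau]; [u1] moreover replaces the
    values outside [Omega] by a fixed element of [Omega].  The set of the replaced
    times is measurable because [Omega] is closed, and null after [tau]. *)
Lemma control_modification tau (u : R -> 'rV[R]_m) :
  admissible_control Omega tau u ->
  exists u0 u1 : R -> 'rV[R]_m,
  [/\ forall j, measurable_fun setT (fun s => u0 s 0 j),
      forall s, tau <= s -> u0 s = u s,
      control Omega u1 & {ae mu, forall s, tau <= s -> u1 s = u s}].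
Proof.
move=> [uL uO]; have [a Oa] := hOmega.
pose u0 s := if tau <= s then u s else a.
have mu0 j : measurable_fun setT (fun s => u0 s 0 j).
  rewrite (_ : (fun s => _) = (fun s => if tau <= s then u s 0 j else a 0 j)); last first.
    by apply/funext => s; rewrite /u0; case: ifP.
  apply: measurable_fun_if => //.
  - by apply: measurable_fun_ler => //; exact: measurable_id.
  - rewrite setTI (_ : _ @^-1` _ = \bigcup_(k : nat) `[tau, tau + k%:R]%classic).
      apply/measurable_fun_bigcup => // k.
      have /(_ _ j) := uL (tau + k%:R); rewrite lerDl ler0n => /(_ isT).
      by move=> /measurable_int/measurable_EFinP.
    apply/seteqP; split=> [s /= ts|s [k _] /=]; last by rewrite in_itv/= => /andP[].
    exists (Num.bound (s - tau)) => //=; rewrite in_itv/= ts/= -lerBlDl.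
    by rewrite ltW// archi_boundP// subr_ge0.
have mA : measurable (u0 @^-1` Omega).
  rewrite -(setCK Omega) preimage_setC; apply: measurableC.
  apply: (@measurable_rV_preimage_open _ _ u0 (~` Omega) mu0); apply: closed_openC.
  by apply: compact_closed => //; exact: norm_hausdorff.
pose u1 s := if `[< Omega (u0 s) >] then u0 s else a.
exists u0, u1; split=> //.
- by move=> s ts; rewrite /u0 ts.
- split=> [s|j]; first by rewrite /u1; case: ifPn => // /asboolP.
  rewrite (_ : (fun s => _) = (fun s => if `[< Omega (u0 s) >] then u0 s 0 j else a 0 j)); last first.
    by apply/funext => s; rewrite /u1; case: ifP.
  apply: measurable_fun_ifT; [|exact: mu0|exact: measurable_cst].
  apply: (measurable_fun_bool true); rewrite setTI.
  rewrite (_ : _ @^-1` _ = u0 @^-1` Omega)//.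
  by apply/seteqP; split=> s /= /asboolP.
- move: uO; apply: ae_impl => s uOs ts; rewrite /u1 /u0 ts ifT//.
  exact/asboolP/uOs.
Qed.

(** The modified control agrees with [u] almost everywhere after [tau], so neither the
    integral equation nor the cost changes. *)
Lemma finite_cost_trajectory tau z (x : R -> 'rV[R]_n) (u : R -> 'rV[R]_m) :
  0 <= tau -> finite_cost_processes l f Omega delta tau z (x, u) ->
  exists u1 x1, [/\ control Omega u1, trajectory F tau z u1 x1 &
    cost l delta tau x u = (payoff L tau x1 u1)%:E].
Proof.
move=> tau0 [/= [cu ac xE] _ _].
have [u0 [u1 [mu0 u0E cu1 u1E]]] := control_modification cu.
pose x1 t := x (Num.max tau t).
have x1E t : tau <= t -> x1 t = x t by move=> tt; rewrite /x1 max_r.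
have lx1 : lbmv x1.
  move=> i; apply: lbm_continuous => t.
  apply: (@cvg_comp _ _ _ x1 (fun v : 'rV[R]_n => v 0 i)); last exact: coord_continuous.
  exact: abs_continuous_clamp.
have lF := lbmv_dynamics F_continuous F_growth cu1 lx1.
have tx1 : trajectory F tau z u1 x1.
  split=> // t tt; rewrite x1E//; apply/rowP => i; rewrite !mxE.
  have [fi ->] := xE t tt i; congr (_ + _); rewrite /integ /Rintegral; congr fine.
  apply: ae_eq_integral => //.
  - exact: measurable_int fi.
  - exact: measurable_int (lbm_integrable tau t (lF i)).
  - move: u1E; apply: ae_impl => s us; rewrite /= in_itv/= => /andP[ts _].
    by rewrite x1E// us// FE//; exact: le_trans ts.
exists u1, x1; split=> //.
have [iL _] := payoff_integrable hK1 K1_delta F_continuous F_growth L_continuous L_growth cu1 tx1.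
rewrite /payoff /Rintegral fineK; last exact: (integrable_fin_num _ iL).
apply: ae_eq_integral => //.
- apply: (eq_measurable_fun (EFin \o (fun s => L s (x1 s) (u0 s)))).
    move=> s; rewrite inE/= in_itv/= andbT => ts.
    by rewrite /running_cost x1E// u0E// LE//; exact: le_trans ts.
  apply/measurable_EFinP; apply: measurable_funTS.
  pose G (p : R * 'rV[R]_n * 'rV[R]_m) := L p.1.1 p.1.2 p.2.
  by apply: (@measurable_along_curves _ _ _ G) => // i; have [] := lx1 i.
- exact: measurable_int iL.
- move: u1E; apply: ae_impl => s us; rewrite /= in_itv/= andbT => ts.
  by rewrite /running_cost x1E// us// LE//; exact: le_trans ts.
Qed.

Let Phi tau z := fine (value l f Omega delta tau z).

Let control_exists : exists u, control Omega u.
Proof.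
have [a Oa] := hOmega; exists (fun=> a); split=> // j; exact: measurable_cst.
Qed.

Lemma value_fin_num tau (z : 'rV[R]_n) : 0 <= tau ->
  value l f Omega delta tau z \is a fin_num.
Proof.
move=> tau0; rewrite fin_numE -ltey -ltNye; apply/andP; split.
  pose B := K1 * (enorm z + K2 / K1) * expR (- delta * tau) / (delta - K1).
  apply: (@lt_le_trans _ _ (- B)%:E); first exact: ltNyr.
  apply: le_ereal_inf_tmp => _ [[x u] fc <-] /=.
  have [u1 [x1 [cu1 tx1 ->]]] := finite_cost_trajectory tau0 fc.
  rewrite lee_fin.
  have [_] := payoff_integrable hK1 K1_delta F_continuous F_growth L_continuous L_growth cu1 tx1.
  by rewrite ler_norml => /andP[].
have [u cu] := control_exists.
have [x tx] := trajectory_exists hK1 hK2 F_continuous F_lip F_growth tau z cu.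
have [fc costE] := trajectory_finite_cost tau0 cu tx.
apply: le_lt_trans (ltry (payoff L tau x u)); rewrite -costE.
by apply: ereal_inf_lbound; exists (x, u).
Qed.

Let Phi_le tau z u x : 0 <= tau -> control Omega u -> trajectory F tau z u x ->
  Phi tau z <= payoff L tau x u.
Proof.
move=> tau0 cu tx; have [fc costE] := trajectory_finite_cost tau0 cu tx.
rewrite -lee_fin -costE fineK ?value_fin_num//.
by apply: ereal_inf_lbound; exists (x, u).
Qed.

Let Phi_opt tau z (e : R) : 0 <= tau -> 0 < e -> exists u x,
  [/\ control Omega u, trajectory F tau z u x & payoff L tau x u <= Phi tau z + e].
Proof.
move=> tau0 e0.
have [_ [[x u] fc <-] /= lt_e] := lb_ereal_inf_adherent e0 (value_fin_num z tau0).
have [u1 [x1 [cu1 tx1 costE]]] := finite_cost_trajectory tau0 fc.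
exists u1, x1; split=> //.
by rewrite -lee_fin -costE EFinD fineK ?value_fin_num// ltW.
Qed.

Lemma value_dini_solution : dini_solution (hamiltonian l f Omega delta) Phi.
Proof.
split.
- exact: (value_continuous hK1 hK2 K1_delta F_continuous F_lip F_growth
    L_continuous L_lip L_growth Phi_le Phi_opt).
- move=> tau z tau0 g gsup.
  have : ((- g.1)%:E <= hamiltonian l f Omega delta tau z g.2)%E.
    apply: le_ereal_inf_tmp => _ [a Oa <-]; rewrite lee_fin.
    have := value_supergradient hK1 hK2 K1_delta F_continuous F_lip F_growth
      L_continuous L_growth Phi_le Phi_opt tau0 Oa gsup.
    by rewrite FE// LE//; lra.
  by move=> /(leeD2l g.1%:E); rewrite -EFinD subrr.
- by move=> K; apply: (value_vanishes hK1 hK2 K1_delta F_continuous F_growth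
    L_continuous L_growth Phi_le Phi_opt).
- move=> tau z tau0 g gsub; apply/lee_addgt0Pr => e e0; rewrite add0e.
  have [a Oa] := value_subgradient hK1 hK2 K1_delta F_continuous F_growth
      L_continuous L_growth Phi_le Phi_opt tau0 e0 hA5 gsub.
  rewrite FE// LE// => lt_e.
  have le_a : (hamiltonian l f Omega delta tau z g.2 <=
      (dotv g.2 (f tau z a) + expR (- (delta * tau)) * l tau z a)%:E)%E.
    by apply: ereal_inf_lbound; exists a.
  by apply: le_trans (leeD2l g.1%:E le_a) _; rewrite -EFinD lee_fin addrA ltW.
Qed.

End Reduction.

Theorem theorem12 (R : realType) (n m : nat)
    (l : R -> 'rV[R]_n -> 'rV[R]_m -> R)
    (f : R -> 'rV[R]_n -> 'rV[R]_m -> 'rV[R]_n)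
    (Omega : set 'rV[R]_m) (delta K1 K2 : R)
    (hOmega : Omega !=set0) (hdelta : 0 < delta)
    (hK1 : 0 < K1) (hK2 : 0 < K2)
    (hA1 : assumption1 l f Omega K1)
    (hA2 : assumption2 l f Omega K2)
    (hA3 : assumption3 l f)
    (hA4 : assumption4 l f Omega delta)
    (hA5 : assumption5 Omega)
    (hA6 : assumption6 l f Omega delta K1) :
  (forall (tau : R) (z : 'rV[R]_n), 0 <= tau -> value l f Omega delta tau z \is a fin_num) /\
  dini_solution (hamiltonian l f Omega delta)
    (fun tau z => fine (value l f Omega delta tau z)).
Proof.
have K1_delta : K1 < delta by rewrite -subr_lt0; have [] := hA6.
split; first by move=> tau z; exact: (value_fin_num hOmega hK1 hK2 hA1 hA2 hA3 hA5 K1_delta).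
exact: (value_dini_solution hOmega hK1 hK2 hA1 hA2 hA3 hA5 K1_delta).
Qed.
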